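(* Consider the composite SBMD method described in the context with uniform probabilities $p_1=\dots=p_b=1/b$, and suppose the stepsizes $\gamma_k>0$ and weights $\theta_k$ satisfy, for all $k\ge1$, \[ \gamma_k\le\frac1{2\bar L},\quad \bar L:=\max_{i=1,\dots,b}L_i,\qquad \theta_{k+1}=b\gamma_k-(b-1)\gamma_{k+1}. \] Then for any $N\ge2$, \[ \mathbb{E}[\phi(\bar x_N)-\phi(x^* )]\le\left(\sum_{k=2}^{N+1}\theta_k\right)^{-1}\left[(b-1)\gamma_1[\phi(x_1)-\phi(x^* )]+b\sum_{i=1}^bV_i(x_1^{(i)},x^{*(i)})+\sigma^2\sum_{k=1}^N\gamma_k^2\right], \] where $x^*$ is an arbitrary optimal solution of $\min_{x\in X}\phi(x)$ and $\sigma=(\sum_{i=1}^b\sigma_i^2)^{1/2}$.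
   Context: Block structure: for $i=1,\dots,b$, $X_i\subseteq\mathbb{R}^{n_i}$ is a nonempty closed convex set, $X=X_1\times\cdots\times X_b\subseteq\mathbb{R}^n$. Each $\mathbb{R}^{n_i}$ carries a norm $\|\cdot\|_i$ with dual $\|\cdot\|_{i,*}$; $U_i\in\mathbb{R}^{n\times n_i}$ satisfy $(U_1,\dots,U_b)=I_n$, $x^{(i)}:=U_i^Tx$. Problem: $\phi(x)=f(x)+\chi(x)$ on $X$, where $f(x)=\mathbb{E}[F(x,\xi)]$ is convex and differentiable with gradient $g$, $g_i:=U_i^Tg$, and $\|g_i(x+U_i\rho)-g_i(x)\|_{i,*}\le L_i\|\rho\|_i$ whenever $x,x+U_i\rho\in X$; $\chi(x)=\sum_{i=1}^b\chi_i(x^{(i)})$ with each $\chi_i:\mathbb{R}^{n_i}\to\mathbb{R}$ closed convex. A stochastic oracle returns $G(x,\xi)$ with $\mathbb{E}[G(x,\xi)]=g(x)$ and $\mathbb{E}[\|G_i(x,\xi)-g_i(x)\|_{i,*}^2]\le\sigma_i^2$ for all $x\in X$, where $G_i=U_i^TG$. The problem has an optimal solution $x^*$. Prox setup: $\omega_i:X_i\to\mathbb{R}$ continuously differentiable, 1-strongly convex w.r.t. $\|\cdot\|_i$; $V_i(z,x)=\omega_i(x)-\omega_i(z)-\langle\nabla\omega_i(z),x-z\rangle$. Composite prox-mapping: $\mathcal P_i(x,y,\gamma)=\arg\min_{z\in X_i}\{\langle y,z-x\rangle+\frac1\gamma V_i(x,z)+\chi_i(z)\}$. Composite SBMD method: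 given $x_1\in X$, stepsizes $\gamma_k$, weights $\theta_k$ with $\theta_1=0$; $\xi_1,\xi_2,\dots$ i.i.d. copies of $\xi$, $i_1,i_2,\dots$ i.i.d. with $\mathrm{Prob}(i_k=i)=p_i$ independent of the $\xi_k$. For $k=1,\dots,N$: $x_{k+1}^{(i_k)}=\mathcal P_{i_k}(x_k^{(i_k)},G_{i_k}(x_k,\xi_k),\gamma_k)$ and $x_{k+1}^{(i)}=x_k^{(i)}$ for $i\ne i_k$. Output $\bar x_N=\left(\sum_{k=2}^{N+1}\theta_k\right)^{-1}\sum_{k=2}^{N+1}\theta_kx_k$. Expectations w.r.t. $\{i_k\},\{\xi_k\}$.
   Formalization: The weights are additionally assumed nonnegative, θ_k ≥ 0 for k = 2,…,N+1, with positive sum; without this the bound can fail for N = 2, b = 2 with a negative θ_3. The oracle G is taken jointly measurable. *)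

(* Defs.v *)
From HB Require Import structures.
From mathcomp Require Import all_boot all_order all_algebra.
From mathcomp Require Import all_classical all_reals all_analysis.
Set Implicit Arguments. Unset Strict Implicit. Unset Printing Implicit Defensive.
Import Order.TTheory GRing.Theory Num.Theory.
Import numFieldNormedType.Exports.
Local Open Scope classical_set_scope.
Local Open Scope ring_scope.

Section SBMD_defs.
Variable R : realType.

Definition dotv {m} (u v : 'rV[R]_m) : R := \sum_(j < m) u 0 j * v 0 j.

Definition is_norm {m} (N : 'rV[R]_m -> R) : Prop :=
  [/\ forall x, N x = 0 -> x = 0,
      forall (a : R) x, N (a *: x) = `|a| * N x &
      forall x y, N (x + y) <= N x + N y].

Definition dual_norm {m} (N : 'rV[R]_m -> R) (y : 'rV[R]_m) : R :=
  sup [set dotv y z | z in [set z | N z <= 1]].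

Definition convex_set_rv {m} (A : set 'rV[R]_m) : Prop :=
  forall x y (t : R), A x -> A y -> 0 <= t <= 1 -> A (t *: x + (1 - t) *: y).

Definition convex_fun_on {m} (A : set 'rV[R]_m) (h : 'rV[R]_m -> R) : Prop :=
  forall x y (t : R), A x -> A y -> 0 <= t <= 1 ->
    h (t *: x + (1 - t) *: y) <= t * h x + (1 - t) * h y.

Definition strongly_convex_on {m} (N : 'rV[R]_m -> R) (A : set 'rV[R]_m)
  (h : 'rV[R]_m -> R) : Prop :=
  forall x y (t : R), A x -> A y -> 0 <= t <= 1 ->
    h (t *: x + (1 - t) *: y)
      <= t * h x + (1 - t) * h y - 2^-1 * t * (1 - t) * N (x - y) ^+ 2.

Definition gradient_on {m} (N : 'rV[R]_m -> R) (A : set 'rV[R]_m)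
  (h : 'rV[R]_m -> R) (dh : 'rV[R]_m -> 'rV[R]_m) : Prop :=
  forall x, A x -> forall e : R, 0 < e -> exists2 d : R, 0 < d &
    forall y, A y -> N (y - x) < d ->
      `|h y - h x - dotv (dh x) (y - x)| <= e * N (y - x).

Definition bregman {m} (w : 'rV[R]_m -> R) (dw : 'rV[R]_m -> 'rV[R]_m)
  (z x : 'rV[R]_m) : R :=
  w x - w z - dotv (dw z) (x - z).

Definition is_prox {m} (A : set 'rV[R]_m) (w : 'rV[R]_m -> R)
  (dw : 'rV[R]_m -> 'rV[R]_m) (chi : 'rV[R]_m -> R)
  (x y : 'rV[R]_m) (gam : R) (z : 'rV[R]_m) : Prop :=
  A z /\ forall u, A u ->
    dotv y (z - x) + bregman w dw x z / gam + chi z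
      <= dotv y (u - x) + bregman w dw x u / gam + chi u.

Variables (b : nat) (n : 'I_b -> nat).

(* x : pt,  x i = x^{(i)} = U_i^T x *)
Definition pt := forall i : 'I_b, 'rV[R]_(n i).

Definition in_blocks (X : forall i, set 'rV[R]_(n i)) (x : pt) : Prop :=
  forall i, X i (x i).

Definition pt_lin (a : R) (x : pt) (c : R) (y : pt) : pt :=
  fun i => a *: x i + c *: y i.

Definition pt_dot (u v : pt) : R := \sum_(i < b) dotv (u i) (v i).

Definition pt_norm (N : forall i, 'rV[R]_(n i) -> R) (x : pt) : R :=
  \sum_(i < b) N i (x i).

Definition convex_fun_pt (X : forall i, set 'rV[R]_(n i)) (h : pt -> R) : Prop :=
  forall x y (t : R), in_blocks X x -> in_blocks X y -> 0 <= t <= 1 ->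
    h (pt_lin t x (1 - t) y) <= t * h x + (1 - t) * h y.

Definition gradient_pt (N : forall i, 'rV[R]_(n i) -> R)
  (X : forall i, set 'rV[R]_(n i)) (h : pt -> R) (g : pt -> pt) : Prop :=
  forall x, in_blocks X x -> forall e : R, 0 < e -> exists2 d : R, 0 < d &
    forall y, in_blocks X y -> pt_norm N (pt_lin 1 y (-1) x) < d ->
      `|h y - h x - pt_dot (g x) (pt_lin 1 y (-1) x)|
        <= e * pt_norm N (pt_lin 1 y (-1) x).

Definition phi_obj (f : pt -> R) (chi : forall i, 'rV[R]_(n i) -> R) (x : pt) : R :=
  f x + \sum_(i < b) chi i (x i).

Section Prob.
Context {dXi : measure_display} {Xi : measurableType dXi}.

(* generators of the product sigma-algebra  Borel(R^n) (x) F_Xi  on pt * Xi *)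
Definition pt_Xi_gen : set (set (pt * Xi)) :=
  fun S => (exists i (j : 'I_(n i)) (B : set R),
              measurable B /\ S = [set p : pt * Xi | B (p.1 i 0 j)])
        \/ (exists A : set Xi, measurable A /\ S = [set p : pt * Xi | A p.2]).

Definition jointly_measurable (G : pt -> Xi -> pt) : Prop :=
  forall i (j : 'I_(n i)) (B : set R), measurable B ->
    <<s pt_Xi_gen >> [set p : pt * Xi | B (G p.1 p.2 i 0 j)].

Context {dO : measure_display} {Omega : measurableType dO}.

(* the family xi_1, xi_2, ..., i_1, i_2, ... (indices >= 1) is mutually
   independent: product rule for every finite subfamily (unused indices are
   dropped by taking the whole space as event) *)
Definition mutually_independent (P : probability Omega R)
  (xi : nat -> Omega -> Xi) (ik : nat -> Omega -> 'I_b) : Prop :=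
  forall (m : nat) (A : nat -> set Xi) (S : nat -> set 'I_b),
    (forall k, measurable (A k)) ->
    P (\big[setI/setT]_(1 <= k < m) (xi k @^-1` A k `&` ik k @^-1` S k))
    = (\prod_(1 <= k < m) (P (xi k @^-1` A k) * P (ik k @^-1` S k)))%E.

End Prob.
End SBMD_defs.

(* Main.v *)
(* Let V be the sum of the Bregman distances to x^* and D = phi - phi^*. The three-point
   inequality for the prox step and the block descent lemma bound b V + b gamma_k D after
   a step in block i by a nonnegative quantity depending only on x_k, xi_k and i.
   Averaging it over xi_k, and then over the uniform index i with the gradient inequality
   of f, gives E[b V_{k+1} + b gamma_k D_{k+1}] <= E[b V_k + (b-1) gamma_k D_k]
   + gamma_k^2 sigma^2, which telescopes because theta_{k+1} = b gamma_k - (b-1) gamma_{k+1};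
   Jensen's inequality concludes. As every term is nonnegative, Tonelli's theorem replaces
   conditional expectations, and no integrability has to be checked. The iterates are
   measurable in the past because the prox map is Lipschitz in (nabla omega_i(x), y). *)
Require Import Defs.
From HB Require Import structures.
From mathcomp Require Import all_boot all_order all_algebra.
From mathcomp Require Import all_classical all_reals all_analysis.
From mathcomp Require Import measurable_realfun ring lra.
Import Order.TTheory GRing.Theory Num.Theory.
Import numFieldNormedType.Exports.
Local Open Scope classical_set_scope.
Local Open Scope ring_scope.

(** The bound after a step contains a term linear in the oracle value, which has no sign, so its
    nonnegativity is a real claim. It must hold for every block, while a prox point is given only
    for the drawn one; the argument therefore tests optimality of [xstar] at the point obtained from
    the iterate by replacing one block with that of [xstar]. Both this claim and the step estimate
    end in the same square: with [r] the norm of the displacement in the block and [d] the dual norm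
    of the noise, [2 * L i * gam k <= 1] leaves [r^2/4], and [r^2/4 - gam k * d * r + gam k^2 * d^2]
    is a square. This fixes the constant 2 and the coefficient of the variance. Two modelling
    choices shape the rest. Gradients are relative to [X], so first-order facts are one-sided
    derivatives along segments. The prox step is a relation, so no iterate is a formula in the
    draws: the past is [Omega] itself with a coarser sigma-algebra, and measurability comes from
    estimates comparing two outcomes. *)

Section dotv_theory.
Context {R : realType} {m : nat}.
Implicit Types (x y z : 'rV[R]_m) (a : R).

(** * The pairing and its bound by the sup norm *)

Lemma dotvDl x y z : dotv (x + y) z = dotv x z + dotv y z.
Proof. by rewrite -big_split; apply: eq_bigr => j _; rewrite mxE mulrDl. Qed.

Lemma dotvDr x y z : dotv x (y + z) = dotv x y + dotv x z.
Proof. by rewrite -big_split; apply: eq_bigr => j _; rewrite mxE mulrDr. Qed.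

Lemma dotvZl a x y : dotv (a *: x) y = a * dotv x y.
Proof. by rewrite mulr_sumr; apply: eq_bigr => j _; rewrite mxE mulrA. Qed.

Lemma dotvZr a x y : dotv x (a *: y) = a * dotv x y.
Proof. by rewrite mulr_sumr; apply: eq_bigr => j _; rewrite mxE mulrCA. Qed.

Lemma dotvNl x y : dotv (- x) y = - dotv x y.
Proof. by rewrite -scaleN1r dotvZl mulN1r. Qed.

Lemma dotvNr x y : dotv x (- y) = - dotv x y.
Proof. by rewrite -scaleN1r dotvZr mulN1r. Qed.

Lemma dotvBl x y z : dotv (x - y) z = dotv x z - dotv y z.
Proof. by rewrite dotvDl dotvNl. Qed.

Lemma dotvBr x y z : dotv x (y - z) = dotv x y - dotv x z.
Proof. by rewrite dotvDr dotvNr. Qed.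

Lemma dotv0r x : dotv x 0 = 0.
Proof. by rewrite -(scale0r 0) dotvZr mul0r. Qed.

Lemma coord_le_norm x j : `|x 0 j| <= `|x|.
Proof.
rewrite [leRHS]mx_normrE.
exact: (@le_bigmax _ _ _ _ (fun ij : 'I_1 * 'I_m => `|x ij.1 ij.2|) (0, j)).
Qed.

Lemma dotv_le x y : `|dotv x y| <= m%:R * `|x| * `|y|.
Proof.
apply: (le_trans (ler_norm_sum _ _ _)).
have -> : m%:R * `|x| * `|y| = \sum_(j < m) `|x| * `|y|.
  by rewrite sumr_const card_ord -mulrA mulr_natl.
by apply: ler_sum => j _; rewrite normrM ler_pM// coord_le_norm.
Qed.

End dotv_theory.

(** * Arbitrary norms on row vectors and their duals *)

Section norm_theory.
Context {R : realType} {m : nat} {N : 'rV[R]_m -> R} (HN : is_norm N).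
Implicit Types (x y z : 'rV[R]_m) (a : R).

Lemma is_normZ a x : N (a *: x) = `|a| * N x. Proof. by case: HN. Qed.

Lemma is_normD x y : N (x + y) <= N x + N y. Proof. by case: HN. Qed.

Lemma is_norm0 : N 0 = 0.
Proof. by rewrite -(scale0r 0) is_normZ normr0 mul0r. Qed.

Lemma is_normN x : N (- x) = N x.
Proof. by rewrite -scaleN1r is_normZ normrN1 mul1r. Qed.

Lemma is_normB x y : N (x - y) = N (y - x).
Proof. by rewrite -is_normN opprB. Qed.

Lemma is_norm_ge0 x : 0 <= N x.
Proof. by have := is_normD x (- x); rewrite subrr is_norm0 is_normN; lra. Qed.

Lemma is_norm_sum {I : finType} (v : I -> 'rV[R]_m) : N (\sum_i v i) <= \sum_i N (v i).
Proof.
elim/big_rec2 : _ => [|i a x _ le]; first by rewrite is_norm0.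
by apply: (le_trans (is_normD _ _)); rewrite lerD2l.
Qed.

Lemma is_norm_upper : exists2 K : R, 0 < K & forall x, N x <= K * `|x|.
Proof.
(* The summand 1 keeps the constant positive when [m = 0]. *)
exists (1 + \sum_j N (delta_mx 0 j)) => [|x].
  by rewrite ltr_pwDl// sumr_ge0// => j _; exact: is_norm_ge0.
rewrite {1}(row_sum_delta x); apply: (le_trans (is_norm_sum _)).
rewrite mulrDl mul1r -[leLHS]add0r lerD// mulr_suml; apply: ler_sum => j _.
by rewrite is_normZ mulrC ler_wpM2l ?is_norm_ge0// coord_le_norm.
Qed.

Lemma is_norm_dist x y : `|N x - N y| <= N (x - y).
Proof.
have := is_normD (x - y) y; have := is_normD (y - x) x.
by rewrite !subrK (is_normB y x) ler_norml; lra.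
Qed.

Lemma is_norm_continuous : continuous N.
Proof.
have [K K0 NK] := is_norm_upper.
move=> x A /nbhs_ballP[e /= e0 eA]; apply/nbhs_ballP.
exists (e / K); first by rewrite /= divr_gt0.
move=> y; rewrite mx_norm_ball /ball_ /= => xy; apply: eA; rewrite /ball /=.
apply: (le_lt_trans (is_norm_dist _ _)); apply: (le_lt_trans (NK _)).
by rewrite -ltr_pdivlMl// mulrC.
Qed.

(** The continuous [N] attains a minimum on the compact sup-norm sphere; definiteness makes it
    positive and homogeneity spreads the bound to all vectors. *)
Lemma is_norm_lower : exists2 C : R, 0 < C & forall x, `|x| <= C * N x.
Proof.
(* An empty sphere means that 0 is the only vector, and then any constant works. *)
have [[x0 x01]|nS] := pselect ([set x : 'rV[R]_m | `|x| = 1] !=set0); last first.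
  exists 1 => // x; have [->|x0] := eqVneq x 0; first by rewrite normr0 is_norm0 mulr0.
  exfalso; apply: nS; exists (`|x|^-1 *: x) => /=.
  by rewrite normrZ normfV normr_id mulVf// normr_eq0.
have cS : compact [set x : 'rV[R]_m | `|x| = 1].
  apply: bounded_closed_compact.
    exists 1; split=> // M M1 x /= ->; exact: ltW.
  apply: (@preimage_closed _ _ (fun x : 'rV[R]_m => `|x|) [set 1]) => [x _|].
    exact: norm_continuous.
  exact: closed_eq.
have [] := @EVT_min_rV R m N _ _ cS.
- by exists x0.
- by apply: continuous_subspaceT; exact: is_norm_continuous.
move=> c /set_mem /= c1 cmin.
have Nc : 0 < N c.
  rewrite lt_neqAle is_norm_ge0 andbT eq_sym; apply/eqP => N0.
  have : c = 0 by case: HN => + _ _; apply.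
  by move=> c0; move: c1; rewrite c0 normr0 => /esym/eqP; rewrite oner_eq0.
exists (N c)^-1 => [|x]; first by rewrite invr_gt0.
have [->|x0'] := eqVneq x 0; first by rewrite normr0 is_norm0 mulr0.
have nx : 0 < `|x| by rewrite normr_gt0.
rewrite ler_pdivlMl// -ler_pdivlMr//.
have := cmin (`|x|^-1 *: x); rewrite is_normZ normfV normr_id mulrC; apply.
by rewrite inE /= normrZ normfV normr_id mulVf// gt_eqF.
Qed.

(** [sup] has its intended value only on nonempty bounded sets, so the properties of [dual_norm]
    rest on this; boundedness is where norm equivalence enters. *)
Lemma dual_has_sup y : has_sup [set dotv y z | z in [set z | N z <= 1]].
Proof.
split; first by exists 0, 0; [rewrite /= is_norm0|rewrite dotv0r].
have [C C0 CN] := is_norm_lower.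
exists (m%:R * `|y| * C) => _ [z /= z1 <-].
apply: (le_trans (ler_norm _)); apply: (le_trans (dotv_le _ _)).
rewrite ler_wpM2l ?mulr_ge0//; apply: (le_trans (CN z)).
by rewrite ler_piMr// ltW.
Qed.

Lemma dual_norm_ge0 y : 0 <= dual_norm N y.
Proof.
apply: ub_le_sup; first by case: (dual_has_sup y).
by exists 0; [rewrite /= is_norm0|rewrite dotv0r].
Qed.

Lemma dotv_le_dual y z : dotv y z <= dual_norm N y * N z.
Proof.
have [z0|z0] := eqVneq z 0; first by rewrite z0 dotv0r is_norm0 mulr0.
have Nz : 0 < N z.
  rewrite lt_neqAle is_norm_ge0 andbT eq_sym; apply/eqP => Nz0.
  by move/eqP: z0; apply; case: HN => + _ _; apply.
rewrite -ler_pdivrMr// mulrC -dotvZr; apply: ub_le_sup.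
  by case: (dual_has_sup y).
exists ((N z)^-1 *: z) => //=.
by rewrite is_normZ normfV ger0_norm ?is_norm_ge0// mulVf// gt_eqF.
Qed.

Lemma dual_normD x y : dual_norm N (x + y) <= dual_norm N x + dual_norm N y.
Proof.
apply: ge_sup; first by case: (dual_has_sup (x + y)).
move=> _ [z /= z1 <-]; rewrite dotvDl.
by apply: lerD; apply: ub_le_sup; [case: (dual_has_sup x)|exists z|
  case: (dual_has_sup y)|exists z].
Qed.

Lemma dual_norm_upper : exists2 K : R, 0 < K & forall y, dual_norm N y <= K * `|y|.
Proof.
have [C C0 CN] := is_norm_lower.
exists (m%:R * C + 1) => [|y]; first by rewrite ltr_wpDl// mulr_ge0// ltW.
apply: ge_sup; first by case: (dual_has_sup y).
move=> _ [z /= z1 <-].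
apply: (le_trans (ler_norm _)); apply: (le_trans (dotv_le _ _)).
rewrite mulrDl mul1r -[leLHS]addr0 lerD// mulrAC ler_wpM2r//.
rewrite ler_wpM2l//; apply: (le_trans (CN z)).
by rewrite ler_piMr// ltW.
Qed.

(** Gives continuity of the dual norm, hence measurability of the noise term. *)
Lemma dual_norm_dist : exists2 K : R, 0 < K &
  forall x y, `|dual_norm N x - dual_norm N y| <= K * `|x - y|.
Proof.
have [K K0 HK] := dual_norm_upper; exists K => // x y.
have := dual_normD (x - y) y; have := dual_normD (y - x) x.
have := HK (x - y); have := HK (y - x).
by rewrite !subrK (distrC y x) ler_norml; lra.
Qed.

End norm_theory.

(** * One-sided derivatives at the left end of a segment *)

Section first_order.
Context {R : realType}.
Local Set Implicit Arguments.
Local Unset Strict Implicit.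

(** Only [t] in []0, 1]] is tested, because a function restricted to a segment of a convex set is
    controlled there and nowhere else. *)
Definition right_derivative0 (h : R -> R) (D : R) : Prop :=
  forall e : R, 0 < e -> exists2 d : R, 0 < d &
    forall t, 0 < t <= 1 -> t < d -> `|h t - h 0 - t * D| <= e * t.

(** First-order optimality at 0 of the sum of a linear term of slope [c] and of [h]: divide by [t]
    and let [t] tend to 0. *)
Lemma right_derivative0_min (h : R -> R) (D c : R) :
  right_derivative0 h D ->
  (forall t, 0 < t <= 1 -> 0 <= t * c + (h t - h 0)) -> 0 <= c + D.
Proof.
move=> hD hc; apply/ler_addgt0Pr => e e0; have [d d0 hd] := hD _ e0.
pose t := Num.min 1 (d / 2).
have t0 : 0 < t by rewrite lt_min ltr01 divr_gt0.
have t1 : t <= 1 by rewrite ge_min lexx.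
have td : t < d by rewrite gt_min; apply/orP; right; lra.
have := hd t; have := hc t; rewrite t0 t1 /= => /(_ isT) h1 /(_ isT td).
rewrite ler_norml => /andP[_ h2].
have : 0 <= t * (c + D + e) by lra.
by rewrite pmulr_rge0//.
Qed.

(** Divide the convexity bound by [t] and let [t] tend to 0. With [q = 0] it yields the gradient
    inequality, with [q] half a squared norm the quadratic lower bound on a Bregman distance. *)
Lemma right_derivative0_convex (h : R -> R) (D q : R) :
  right_derivative0 h D ->
  (forall t, 0 < t <= 1 -> h t <= t * h 1 + (1 - t) * h 0 - q * t * (1 - t)) ->
  h 0 + D + q <= h 1.
Proof.
move=> hD hc; apply/ler_addgt0Pr => e e0.
have e2 : 0 < e / 2 by rewrite divr_gt0.
have [d d0 hd] := hD _ e2.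
(* Half of [e] pays for the derivative error, the other half for [q * t]; [+ 1] guards against
   [q = 0]. *)
pose t := Num.min (Num.min 1 (d / 2)) (e / 2 / (`|q| + 1)).
have q0 : 0 < `|q| + 1 by rewrite ltr_wpDl.
have t0 : 0 < t by rewrite !lt_min ltr01 !divr_gt0.
have t1 : t <= 1 by rewrite !ge_min lexx.
have td : t < d by rewrite !gt_min; apply/orP; left; apply/orP; right; lra.
have tq : t * (`|q| + 1) <= e / 2 by rewrite -ler_pdivlMr// ge_min lexx orbT.
have tq' : q * t <= e / 2.
  apply: le_trans tq; rewrite mulrC ler_wpM2l ?(ltW t0)//.
  by apply: (le_trans (ler_norm _)); rewrite lerDl.
have := hd t; have := hc t; rewrite t0 t1 /= => /(_ isT) h1 /(_ isT td).
rewrite ler_norml => /andP[h2 _].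
have : 0 <= t * (h 1 - h 0 - D - q + q * t + e / 2) by lra.
by rewrite pmulr_rge0// => h3; lra.
Qed.

End first_order.

(** * Bregman distance and prox mapping in one block *)

Section block.
Local Set Implicit Arguments.
Local Unset Strict Implicit.
Context {R : realType} {m : nat} {N : 'rV[R]_m -> R} (HN : is_norm N).
Variables (A : set 'rV[R]_m) (cA : convex_set_rv A).

Lemma segmentE (x y : 'rV[R]_m) (t : R) : t *: y + (1 - t) *: x - x = t *: (y - x).
Proof. by rewrite scalerBl scale1r scalerBr addrCA [x + _]addrC addrK. Qed.

Lemma gradient_on_segment (h : 'rV[R]_m -> R) dh x y :
  gradient_on N A h dh -> A x -> A y ->
  right_derivative0 (fun t => h (t *: y + (1 - t) *: x)) (dotv (dh x) (y - x)).
Proof.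
move=> hd Ax Ay e e0.
have N0 : 0 < N (y - x) + 1 by rewrite ltr_wpDl// is_norm_ge0.
have [d d0 hd'] := hd x Ax (e / (N (y - x) + 1)) (divr_gt0 e0 N0).
exists (d / (N (y - x) + 1)) => [|t /andP[t0 t1] td]; first exact: divr_gt0.
have Nt : N (t *: y + (1 - t) *: x - x) = t * N (y - x).
  by rewrite segmentE (is_normZ HN) gtr0_norm.
have := hd' (t *: y + (1 - t) *: x).
rewrite Nt segmentE dotvZr scale0r add0r subr0 scale1r; move=> H; apply: (le_trans (H _ _)).
- by apply: cA => //; rewrite ltW.
- rewrite ltr_pdivlMr// in td; apply: le_lt_trans td.
  by rewrite ler_wpM2l ?(ltW t0)// lerDl.
- rewrite mulrCA [leRHS]mulrC ler_wpM2l ?(ltW t0)//.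
  by rewrite -mulrA ler_piMr ?(ltW e0)// mulrC ler_pdivrMr// mul1r lerDl.
Qed.

Variables (w : 'rV[R]_m -> R) (dw : 'rV[R]_m -> 'rV[R]_m).
Hypotheses (Hdw : gradient_on N A w dw) (Hsc : strongly_convex_on N A w).

Lemma bregman_ge x z : A x -> A z -> 2^-1 * N (z - x) ^+ 2 <= bregman w dw x z.
Proof.
move=> Ax Az; rewrite /bregman.
suff : w x + dotv (dw x) (z - x) + 2^-1 * N (z - x) ^+ 2 <= w z by lra.
have := gradient_on_segment Hdw Ax Az.
move=> /(@right_derivative0_convex _ _ _ (2^-1 * N (z - x) ^+ 2)).
rewrite scale0r add0r subr0 scale1r scale1r subrr scale0r addr0; apply.
move=> t /andP[t0 t1]; have := @Hsc _ _ t Az Ax; rewrite t1 ltW//= => /(_ isT).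
lra.
Qed.

Lemma bregman_ge0 x z : A x -> A z -> 0 <= bregman w dw x z.
Proof. by move=> Ax Az; apply: le_trans (bregman_ge Ax Az); rewrite mulr_ge0// sqr_ge0. Qed.

Lemma gradient_strongly_monotone x z : A x -> A z ->
  N (z - x) ^+ 2 <= dotv (dw z - dw x) (z - x).
Proof.
move=> Ax Az; have := bregman_ge Ax Az; have := bregman_ge Az Ax.
rewrite /bregman (is_normB HN x z) -(opprB z x) dotvNr dotvBl; lra.
Qed.

Variables (chi : 'rV[R]_m -> R) (Hchi : convex_fun_on setT chi).

(** The minimizer is compared with points of the segment towards [u]. Convexity bounds the change of
    [chi] linearly, so no subgradient is taken and only [w] is differentiated. *)
Lemma prox_variational x y gam z u : 0 < gam -> is_prox A w dw chi x y gam z ->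
  A x -> A u -> 0 <= dotv (gam *: y + dw z - dw x) (u - z) + gam * (chi u - chi z).
Proof.
move=> g0 [Az opt] Ax Au; rewrite dotvBl dotvDl addrAC addrC.
rewrite addrA addrAC [in X in _ <= X]addrC.
have := gradient_on_segment Hdw Az Au.
move=> /right_derivative0_min => H.
(* Rearranged so that [dw z] is the one-sided derivative and all the rest is the slope [c] of
   [right_derivative0_min]. *)
suff : 0 <= dotv (gam *: y) (u - z) - dotv (dw x) (u - z) + gam * (chi u - chi z)
   + dotv (dw z) (u - z) by lra.
apply: H => t /andP[t0 t1].
rewrite scale0r add0r subr0 scale1r.
set ut := t *: u + (1 - t) *: z.
have Aut : A ut by apply: cA => //; rewrite ltW.
have := opt ut Aut.
rewrite -(ler_pM2l g0) !mulrDr !(mulrC gam (_ / _)) !divfK ?gt_eqF// => opt'.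
have := @Hchi u z t I I; rewrite t1 ltW//= => /(_ isT) ct.
have utE : ut = z + t *: (u - z).
  by rewrite /ut scalerBl scale1r scalerBr addrCA.
have : chi (z + t *: (u - z)) <= t * chi u + (1 - t) * chi z.
  by apply: le_trans ct; rewrite /ut scalerBl scale1r scalerBr addrCA.
rewrite -(ler_pM2l g0); move: opt'; rewrite utE /bregman !dotvBr !dotvDr !dotvZr !dotvBr dotvZl !dotvZl.
lra.
Qed.

(** The variational inequality combined with the identity [V(x,u) - V(x,z) - V(z,u) = dotv (dw z -
    dw x) (u - z)]. *)
Lemma prox_three_point x y gam z u : 0 < gam -> is_prox A w dw chi x y gam z ->
  A x -> A u ->
  gam * (dotv y (z - x) + chi z) + bregman w dw x z + bregman w dw z u
  <= gam * (dotv y (u - x) + chi u) + bregman w dw x u.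
Proof.
move=> g0 pz Ax Au; have := prox_variational g0 pz Ax Au.
rewrite /bregman dotvBl dotvDl dotvZl !dotvBr; lra.
Qed.

(** Each solution is tested in the variational inequality of the other; in the sum the [chi] terms
    cancel, and strong monotonicity of [dw] leaves the square. *)
Lemma prox_stable x y z x' y' z' gam : 0 < gam ->
  is_prox A w dw chi x y gam z -> is_prox A w dw chi x' y' gam z' ->
  A x -> A x' ->
  N (z - z') ^+ 2 <= dotv (dw x - dw x' - gam *: (y - y')) (z - z').
Proof.
move=> g0 pz pz' Ax Ax'.
have Az := pz.1; have Az' := pz'.1.
have := prox_variational g0 pz Ax Az'.
have := prox_variational g0 pz' Ax' Az.
have := gradient_strongly_monotone Az' Az.
rewrite -(opprB z z') !dotvNr !dotvBl !dotvDl !dotvZl dotvBl; lra.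
Qed.

(** Measured in [dw x] and not in [x], because [dw] is continuous but has no Lipschitz bound. *)
Lemma prox_lipschitz gam : 0 < gam -> exists2 K : R, 0 < K &
  forall x y z x' y' z',
  is_prox A w dw chi x y gam z -> is_prox A w dw chi x' y' gam z' ->
  A x -> A x' -> `|z - z'| <= K * (`|dw x - dw x'| + `|y - y'|).
Proof.
move=> g0; have [C C0 HC] := is_norm_lower HN; have [K K0 HK] := dual_norm_upper HN.
exists (C * K * (1 + gam)) => [|x y z x' y' z' pz pz' Ax Ax'].
  by rewrite !mulr_gt0// addr_gt0.
rewrite -!mulrA; apply: (le_trans (HC _)); rewrite ler_pM2l//.
have [->|n0] := eqVneq (N (z - z')) 0.
  by rewrite mulr_ge0 ?(ltW K0)// mulr_ge0 ?addr_ge0// ltW.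
have Np : 0 < N (z - z') by rewrite lt_neqAle eq_sym n0 is_norm_ge0.
have := prox_stable g0 pz pz' Ax Ax' => /le_trans.
move=> /(_ _ (dotv_le_dual HN _ _)); rewrite expr2 ler_pM2r// => /le_trans; apply.
apply: (le_trans (HK _)); rewrite ler_pM2l//.
apply: (le_trans (ler_normB _ _)); rewrite normrZ gtr0_norm//.
have := normr_ge0 (dw x - dw x'); have := normr_ge0 (y - y'); nra.
Qed.

End block.

(** * Points made of blocks *)

Section block_points.
Context {R : realType} {b : nat} {n : 'I_b -> nat}.
Implicit Types (x y : pt R n) (X : forall i, set 'rV[R]_(n i)).

Lemma in_blocks_lin X x y t : (forall i, convex_set_rv (X i)) ->
  in_blocks X x -> in_blocks X y -> 0 <= t <= 1 -> in_blocks X (pt_lin t x (1 - t) y).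
Proof. by move=> cX Xx Xy t01 i; apply: cX. Qed.

Lemma pt_lin0 x y : pt_lin 0 x (1 - 0) y = y.
Proof. by apply: functional_extensionality_dep => i; rewrite /pt_lin scale0r add0r subr0 scale1r. Qed.

Lemma pt_lin1 x y : pt_lin 1 x (1 - 1) y = x.
Proof. by apply: functional_extensionality_dep => i; rewrite /pt_lin scale1r subrr scale0r addr0. Qed.

Lemma pt_dot_sub (u x y : pt R n) :
  pt_dot u (pt_lin 1 x (-1) y) = \sum_i dotv (u i) (x i - y i).
Proof. by apply: eq_bigr => i _; rewrite /pt_lin scale1r scaleN1r. Qed.

Lemma pt_norm_sub (nrm : forall i, 'rV[R]_(n i) -> R) x y :
  pt_norm nrm (pt_lin 1 x (-1) y) = \sum_i nrm i (x i - y i).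
Proof. by apply: eq_bigr => i _; rewrite /pt_lin scale1r scaleN1r. Qed.

End block_points.

(** * Gradient inequality and block descent for [f] *)

Section objective.
Context {R : realType} {b : nat} {n : 'I_b -> nat}.
Variables (X : forall i, set 'rV[R]_(n i)) (cX : forall i, convex_set_rv (X i)).
Variables (nrm : forall i, 'rV[R]_(n i) -> R) (Hnrm : forall i, is_norm (nrm i)).
Variables (f : pt R n -> R) (g : pt R n -> pt R n).
Hypotheses (Hfconv : convex_fun_pt X f) (Hgrad : gradient_pt nrm X f g).
Implicit Types x y : pt R n.
Local Set Implicit Arguments.
Local Unset Strict Implicit.

Lemma gradient_pt_ineq x y : in_blocks X x -> in_blocks X y ->
  f x + \sum_i dotv (g x i) (y i - x i) <= f y.
Proof.
move=> Xx Xy.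
have := @right_derivative0_convex R (fun t => f (pt_lin t y (1 - t) x))
  (\sum_i dotv (g x i) (y i - x i)) 0.
rewrite pt_lin0 pt_lin1 addr0; apply; last first.
  by move=> t /andP[t0 t1]; rewrite mul0r mul0r subr0; apply: Hfconv => //; rewrite ltW.
move=> e e0; rewrite pt_lin0; set r := \sum_i nrm i (y i - x i).
have r0 : 0 <= r by apply: sumr_ge0 => i _; exact: is_norm_ge0.
have r1 : 0 < r + 1 by rewrite ltr_wpDl.
have [d d0 hd] := Hgrad x Xx _ (divr_gt0 e0 r1).
exists (d / (r + 1)) => [|t /andP[t0 t1] td]; first exact: divr_gt0.
have := hd (pt_lin t y (1 - t) x).
rewrite pt_norm_sub pt_dot_sub.
have -> : \sum_i nrm i (pt_lin t y (1 - t) x i - x i) = t * r.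
  rewrite mulr_sumr; apply: eq_bigr => i _.
  by rewrite /pt_lin segmentE (is_normZ (Hnrm i)) gtr0_norm.
have -> : \sum_i dotv (g x i) (pt_lin t y (1 - t) x i - x i) =
    t * \sum_i dotv (g x i) (y i - x i).
  by rewrite mulr_sumr; apply: eq_bigr => i _; rewrite /pt_lin segmentE dotvZr.
move=> H; apply: (le_trans (H _ _)).
- by apply: in_blocks_lin => //; rewrite ltW.
- rewrite ltr_pdivlMr// in td; apply: le_lt_trans td.
  by rewrite ler_wpM2l ?(ltW t0)// lerDl.
- rewrite mulrCA [leRHS]mulrC ler_wpM2l ?(ltW t0)//.
  by rewrite -mulrA ler_piMr ?(ltW e0)// mulrC ler_pdivrMr// mul1r lerDl.
Qed.

Variables (L : 'I_b -> R).
Hypothesis HLip : forall i x y, in_blocks X x -> in_blocks X y ->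
  (forall j, j != i -> y j = x j) ->
  dual_norm (nrm i) (g y i - g x i) <= L i * nrm i (y i - x i).

(* Summing the gradient inequalities along an equipartition of the segment from x to y
   into k pieces gives the bound with L (1 + 1/k) in place of L. *)
Lemma block_descent i x y : in_blocks X x -> in_blocks X y ->
  (forall j, j != i -> y j = x j) ->
  f y <= f x + dotv (g x i) (y i - x i) + L i / 2 * nrm i (y i - x i) ^+ 2.
Proof.
move=> Xx Xy yx; set r := nrm i (y i - x i); set q := dotv _ _.
have r0 : 0 <= r by exact: is_norm_ge0.
have step (M : nat) (k : nat) : (k <= M.+1)%N ->
    f (pt_lin (k%:R / M.+1%:R) y (1 - k%:R / M.+1%:R) x) <=
    f x + k%:R / M.+1%:R * q
    + L i / 2 * r ^+ 2 * (k%:R * (k%:R + 1)) / M.+1%:R ^+ 2.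
  have M0 : 0 < M.+1%:R :> R by rewrite ltr0Sn.
  elim: k => [_|k IH kM].
    by rewrite !mul0r pt_lin0 mulr0 mul0r !addr0.
  have {}IH := IH (ltnW kM).
  set a : R := k%:R / M.+1%:R in IH *; set c : R := k.+1%:R / M.+1%:R.
  have a01 : 0 <= a <= 1.
    by rewrite divr_ge0//= ler_pdivrMr// mul1r ler_nat ltnW.
  have c01 : 0 <= c <= 1 by rewrite divr_ge0//= ler_pdivrMr// mul1r ler_nat.
  have ca : c = a + M.+1%:R^-1 by rewrite /c /a -natr1 mulrDl mul1r.
  set pa := pt_lin a y (1 - a) x in IH *; set pc := pt_lin c y (1 - c) x.
  have Xa : in_blocks X pa by apply: in_blocks_lin.
  have Xc : in_blocks X pc by apply: in_blocks_lin.
  have pE t j : j != i -> pt_lin t y (1 - t) x j = x j.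
    by move=> ji; rewrite /pt_lin yx// -scalerDl addrC subrK scale1r.
  (* The inequality is taken at the new node [pc] towards the old one [pa]. The excess of the slope
     over [q] is at most [L i * c * r^2], and these sum to the factor [k (k + 1) / 2]. *)
  have := gradient_pt_ineq Xc Xa.
  rewrite (bigD1 i)//= big1 => [|j ji]; last by rewrite /pa /pc !pE// subrr dotv0r.
  have -> : pa i - pc i = - (M.+1%:R^-1 *: (y i - x i)).
    by apply/rowP => j; rewrite /pa /pc /pt_lin ca !mxE; ring.
  rewrite addr0 dotvNr dotvZr.
  have -> : dotv (g pc i) (y i - x i) = dotv (g pc i - g x i) (y i - x i) + q.
    by rewrite dotvBl subrK.
  have Hd : dotv (g pc i - g x i) (y i - x i) <= L i * (c * r) * r.
    apply: (le_trans (dotv_le_dual (Hnrm i) _ _)); rewrite ler_wpM2r//.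
    apply: (le_trans (@HLip i x pc Xx Xc (pE c))).
    by rewrite /pc /pt_lin segmentE (is_normZ (Hnrm i)) ger0_norm//; case/andP: c01.
  have Hd' : M.+1%:R^-1 * dotv (g pc i - g x i) (y i - x i) <=
      M.+1%:R^-1 * (L i * (c * r) * r) by rewrite ler_pM2l// invr_gt0.
  move=> Hg.
  have -> : f x + c * q + L i / 2 * r ^+ 2 * (k.+1%:R * (k.+1%:R + 1)) / M.+1%:R ^+ 2
    = f x + a * q + L i / 2 * r ^+ 2 * (k%:R * (k%:R + 1)) / M.+1%:R ^+ 2
      + M.+1%:R^-1 * q + M.+1%:R^-1 * (L i * (c * r) * r).
    rewrite ca /a -natr1; field; by rewrite gt_eqF.
  rewrite mulrDr in Hg; move: Hg Hd' IH.
  move: (M.+1%:R^-1 * dotv _ _) (M.+1%:R^-1 * (L i * (c * r) * r)) (M.+1%:R^-1 * q).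
  move: (f x + a * q + _) (f pa) (f pc) => *; lra.
apply/ler_addgt0Pr => e e0.
(* The excess after all pieces is [e * K / M], below [e] once the number [M] of pieces exceeds
   [K]. *)
pose K := L i / 2 * r ^+ 2 / e.
have := step (Num.truncn `|K|) _ (leqnn _).
set M := (Num.truncn `|K|).+1; have M0 : 0 < M%:R :> R by rewrite ltr0Sn.
have KM : `|K| < M%:R by exact: truncnS_gt.
rewrite divff ?gt_eqF// pt_lin1 mul1r => /le_trans; apply.
have -> : L i / 2 * r ^+ 2 * (M%:R * (M%:R + 1)) / M%:R ^+ 2 =
   L i / 2 * r ^+ 2 + (e * K) / M%:R.
  by rewrite /K; field; rewrite !gt_eqF.
rewrite addrA lerD2l -mulrA ler_piMr ?(ltW e0)// ler_pdivrMr// mul1r.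
by apply: ltW; apply: le_lt_trans KM; exact: ler_norm.
Qed.

End objective.

(** * One step of the method, pathwise and in mean *)

Section descent_step.
Context {R : realType} {b : nat} {n : 'I_b -> nat}.
Variables (X : forall i, set 'rV[R]_(n i)) (cX : forall i, convex_set_rv (X i)).
Variables (nrm : forall i, 'rV[R]_(n i) -> R) (Hnrm : forall i, is_norm (nrm i)).
Variables (f : pt R n -> R) (g : pt R n -> pt R n).
Hypotheses (Hfconv : convex_fun_pt X f) (Hgrad : gradient_pt nrm X f g).
Variables (L : 'I_b -> R).
Hypothesis HLip : forall i (x y : pt R n), in_blocks X x -> in_blocks X y ->
  (forall j, j != i -> y j = x j) ->
  dual_norm (nrm i) (g y i - g x i) <= L i * nrm i (y i - x i).
Variables (chi : forall i, 'rV[R]_(n i) -> R).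
Hypothesis Hchi : forall i, convex_fun_on setT (chi i).
Variables (w : forall i, 'rV[R]_(n i) -> R) (dw : forall i, 'rV[R]_(n i) -> 'rV[R]_(n i)).
Hypothesis Hdw : forall i, gradient_on (nrm i) (X i) (w i) (dw i).
Hypothesis Hsc : forall i, strongly_convex_on (nrm i) (X i) (w i).
Variables (u : pt R n) (Xu : in_blocks X u).
Hypothesis uopt : forall x, in_blocks X x -> phi_obj f chi u <= phi_obj f chi x.
Implicit Types x y : pt R n.
Local Set Implicit Arguments.
Local Unset Strict Implicit.

Definition gap x : R := phi_obj f chi x - phi_obj f chi u.

Definition total_bregman x : R := \sum_i bregman (w i) (dw i) (x i) (u i).

(* Upper bound on b V + b gm (phi - phi^* ) after a step in block i from x
   with stochastic gradient y. *)
Definition step_bound (gm : R) (i : 'I_b) (x y : pt R n) : R :=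
  b%:R * total_bregman x + b%:R * gm * gap x
  + b%:R * gm * (dotv (y i) (u i - x i) + chi i (u i) - chi i (x i))
  + b%:R * gm ^+ 2 * dual_norm (nrm i) (y i - g x i) ^+ 2.

Lemma gap_ge0 x : in_blocks X x -> 0 <= gap x.
Proof. by move=> Xx; rewrite subr_ge0 uopt. Qed.

Lemma total_bregman_ge0 x : in_blocks X x -> 0 <= total_bregman x.
Proof. by move=> Xx; apply: sumr_ge0 => i _; apply: (bregman_ge0 (Hnrm i)). Qed.

Lemma phi_obj_block i x y : (forall j, j != i -> y j = x j) ->
  phi_obj f chi y = phi_obj f chi x + (f y - f x) + (chi i (y i) - chi i (x i)).
Proof.
move=> yx; rewrite /phi_obj (bigD1 i)//= [\sum_(j < b) chi j (x j)](bigD1 i)//=.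
by rewrite (eq_bigr (fun j => chi j (x j))) => [|j /yx ->//]; ring.
Qed.

(** No prox point is involved, so this covers every block and every oracle value, as Tonelli
    requires. *)
Lemma step_bound_ge0 gm i x y : 0 < gm -> 2 * L i * gm <= 1 -> in_blocks X x ->
  0 <= step_bound gm i x y.
Proof.
move=> g0 Lg Xx; rewrite /step_bound.
set d := dual_norm _ _; pose r := nrm i (u i - x i).
have r0 : 0 <= r by exact: is_norm_ge0.
have d0 : 0 <= d by exact: dual_norm_ge0.
have VE : 2^-1 * r ^+ 2 <= total_bregman x.
  rewrite /total_bregman (bigD1 i)//=.
  have := bregman_ge (Hnrm i) (cX i) (Hdw i) (Hsc i) (Xx i) (Xu i).
  have : 0 <= \sum_(j < b | j != i) bregman (w j) (dw j) (x j) (u j).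
    by apply: sumr_ge0 => j _; apply: (bregman_ge0 (Hnrm j)).
  by rewrite -/r; lra.
(* Moving only block [i] of [x] to the optimum stays feasible, so the gap there is nonnegative;
   block descent turns this into a lower bound on [gap x] plus the linear term. *)
have [y' [y'i y'j]] : exists y' : pt R n, y' i = u i /\ forall j, j != i -> y' j = x j.
  exists (fun j => if j == i then u j else x j); rewrite eqxx; split=> // j.
  by move/negbTE => ->.
have Xy' : in_blocks X y'.
  by move=> j; have [->|/y'j ->//] := eqVneq j i; rewrite y'i.
have := block_descent cX Hnrm Hfconv Hgrad HLip Xx Xy' y'j.
have := gap_ge0 Xy'; rewrite /gap (phi_obj_block y'j) y'i -/r.
rewrite -/(gap x) => H1 H2.
have H3 : - (d * r) <= dotv (y i - g x i) (u i - x i).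
  have := dotv_le_dual (Hnrm i) (y i - g x i) (x i - u i).
  by rewrite (is_normB (Hnrm i)) -/r -/d -[x i - u i]opprB dotvNr; lra.
rewrite dotvBl in H3.
rewrite -(mulrA b%:R gm) -(mulrA b%:R gm (_ + _ - _)) -(mulrA b%:R (gm ^+ 2)) -!mulrDr.
rewrite mulr_ge0//; move: H1; rewrite addrAC -/(gap x) => H1.
have H4 : gm * (- (d * r) - L i / 2 * r ^+ 2) <=
   gm * (gap x + (dotv (y i) (u i - x i) + chi i (u i) - chi i (x i))).
  by rewrite ler_pM2l//; rewrite /gap; lra.
have H5 : 2 * L i * gm * r ^+ 2 <= 1 * r ^+ 2 by rewrite ler_wpM2r// sqr_ge0.
have := sqr_ge0 (r / 2 - gm * d); nra.
Qed.

(** Strong convexity in the three-point inequality gains [r^2/2]; descent costs at most [r^2/4], and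
    the other [r^2/4] absorbs the noise [gm * d * r] at the price [gm^2 * d^2]. *)
Lemma step_boundP gm i x y x' : 0 < gm -> 2 * L i * gm <= 1 -> in_blocks X x ->
  (forall j, j != i -> x' j = x j) ->
  is_prox (X i) (w i) (dw i) (chi i) (x i) (y i) gm (x' i) ->
  b%:R * total_bregman x' + b%:R * gm * gap x' <= step_bound gm i x y.
Proof.
move=> g0 Lg Xx x'x px.
have Xx' : in_blocks X x' by move=> j; have [->|/x'x ->//] := eqVneq j i; case: px.
rewrite /step_bound; set d := dual_norm _ _; pose r := nrm i (x' i - x i).
rewrite -!(mulrA b%:R) -!mulrDr ler_wpM2l//.
have Tx' : total_bregman x' = total_bregman x
    - bregman (w i) (dw i) (x i) (u i) + bregman (w i) (dw i) (x' i) (u i).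
  rewrite /total_bregman (bigD1 i)//= [X in _ = X - _ + _](bigD1 i)//=.
  by rewrite (eq_bigr (fun j => bregman (w j) (dw j) (x j) (u j))) => [|j /x'x ->//]; ring.
have H1 := prox_three_point (Hnrm i) (cX i) (Hdw i) (Hchi i) g0 px (Xx i) (Xu i).
have H2 := block_descent cX Hnrm Hfconv Hgrad HLip Xx Xx' x'x.
have H3 := bregman_ge (Hnrm i) (cX i) (Hdw i) (Hsc i) (Xx i) (Xx' i).
have H4 : dotv (g x i - y i) (x' i - x i) <= d * r.
  have := dotv_le_dual (Hnrm i) (y i - g x i) (x i - x' i).
  by rewrite (is_normB (Hnrm i)) -/r -/d -[x i - x' i]opprB -(opprB (y i)) dotvNr dotvNl; lra.
rewrite dotvBl in H4; rewrite -/r in H2 H3.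
have H5 : gm * gap x' <= gm * (gap x + (d * r + dotv (y i) (x' i - x i)
    + L i / 2 * r ^+ 2) + (chi i (x' i) - chi i (x i))).
  by rewrite ler_pM2l// /gap (phi_obj_block x'x); lra.
have H6 : 2 * L i * gm * r ^+ 2 <= 1 * r ^+ 2 by rewrite ler_wpM2r// sqr_ge0.
rewrite Tx'.
have := sqr_ge0 (r / 2 - gm * d); nra.
Qed.

(** Averaging cancels the factor [b] of the linear terms; their sum over blocks is at most
    [- gap x], which lowers the coefficient of the gap from [b] to [b - 1]. *)
Lemma step_bound_mean gm (sig : 'I_b -> R) x : (0 < b)%N -> 0 < gm -> in_blocks X x ->
  \sum_i b%:R^-1 * (b%:R * total_bregman x + b%:R * gm * gap x
     + b%:R * gm * (dotv (g x i) (u i - x i) + chi i (u i) - chi i (x i))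
     + b%:R * gm ^+ 2 * sig i ^+ 2)
  <= b%:R * total_bregman x + (b%:R - 1) * gm * gap x
     + gm ^+ 2 * \sum_i sig i ^+ 2.
Proof.
move=> b0 g0 Xx; have b0' : b%:R != 0 :> R by rewrite pnatr_eq0 -lt0n.
under eq_bigr => i _.
  have -> : b%:R^-1 * (b%:R * total_bregman x + b%:R * gm * gap x
     + b%:R * gm * (dotv (g x i) (u i - x i) + chi i (u i) - chi i (x i))
     + b%:R * gm ^+ 2 * sig i ^+ 2) =
     total_bregman x + gm * gap x +
     (gm * (dotv (g x i) (u i - x i) + (chi i (u i) - chi i (x i)))
     + gm ^+ 2 * sig i ^+ 2) by field.
  over.
rewrite big_split /= sumr_const card_ord big_split /= -!mulr_sumr -mulr_natl.
rewrite big_split /= sumrB.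
have := gradient_pt_ineq cX Hnrm Hfconv Hgrad Xx Xu => H.
have : gm * (\sum_i dotv (g x i) (u i - x i) + (\sum_i chi i (u i) - \sum_i chi i (x i)))
    <= gm * - gap x by rewrite ler_pM2l// /gap /phi_obj; lra.
by nra.
Qed.

Lemma gap_convex : convex_fun_pt X gap.
Proof.
move=> x y t Xx Xy t01; have := @Hfconv x y t Xx Xy t01.
have : \sum_i chi i (pt_lin t x (1 - t) y i) <=
    \sum_i (t * chi i (x i) + (1 - t) * chi i (y i)).
  by apply: ler_sum => i _; exact: Hchi.
rewrite big_split /= -!mulr_sumr /gap /phi_obj; lra.
Qed.

Lemma gap_average (theta : nat -> R) (x : nat -> pt R n) m k :
  (forall j, (m <= j < k)%N -> 0 <= theta j) ->
  (forall j, (m <= j < k)%N -> in_blocks X (x j)) ->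
  0 < \sum_(m <= j < k) theta j ->
  let xbar : pt R n :=
    fun i => (\sum_(m <= j < k) theta j)^-1 *: \sum_(m <= j < k) theta j *: x j i in
  in_blocks X xbar /\
  (\sum_(m <= j < k) theta j) * gap xbar <= \sum_(m <= j < k) theta j * gap (x j).
Proof.
move=> t0 Xx W0.
pose W k := \sum_(m <= j < k) theta j.
pose xb k : pt R n := fun i => (W k)^-1 *: \sum_(m <= j < k) theta j *: x j i.
(* While the partial weight is 0 the quotient [xb k] is 0 and may be infeasible, so leading zero
   weights form an alternative of their own. *)
suff : [\/ (k <= m)%N,
    [/\ W k = 0, forall i, \sum_(m <= j < k) theta j *: x j i = 0 &
      \sum_(m <= j < k) theta j * gap (x j) = 0] |
    [/\ 0 < W k, in_blocks X (xb k) &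
      W k * gap (xb k) <= \sum_(m <= j < k) theta j * gap (x j)]].
  case=> [km|[Wk0 _ _]|[_ ? ?]]; last by split.
  - by move: W0; rewrite big_geq// ltxx.
  - by move: W0; rewrite -/(W k) Wk0 ltxx.
move: t0 Xx {W0}; elim: k => [|k IH] t0 Xx; first by constructor 1.
have [km|mk] := ltnP k m; first by constructor 1.
have tk : 0 <= theta k by apply: t0; rewrite mk ltnSn.
have Xk : in_blocks X (x k) by apply: Xx; rewrite mk ltnSn.
have WS : W k.+1 = W k + theta k by rewrite /W big_nat_recr.
(* The first positive weight makes the average equal to the point [x k] itself. *)
have Z : W k = 0 -> (forall i, \sum_(m <= j < k) theta j *: x j i = 0) ->
    \sum_(m <= j < k) theta j * gap (x j) = 0 ->
    [\/ false,
    [/\ W k.+1 = 0, forall i, \sum_(m <= j < k.+1) theta j *: x j i = 0 &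
      \sum_(m <= j < k.+1) theta j * gap (x j) = 0] |
    [/\ 0 < W k.+1, in_blocks X (xb k.+1) &
      W k.+1 * gap (xb k.+1) <= \sum_(m <= j < k.+1) theta j * gap (x j)]].
  move=> Wk Sk Gk; have [tk0|tkN] := eqVneq (theta k) 0.
    constructor 2; split; first by rewrite WS Wk tk0 addr0.
      by move=> i; rewrite big_nat_recr//= Sk tk0 scale0r addr0.
    by rewrite big_nat_recr//= Gk tk0 mul0r addr0.
  have xbk : xb k.+1 = x k.
    apply: functional_extensionality_dep => i.
    by rewrite /xb WS Wk add0r big_nat_recr//= Sk add0r scalerA mulVf// scale1r.
  constructor 3; rewrite xbk WS Wk add0r big_nat_recr//= Gk add0r; split=> //.
  by rewrite lt_neqAle eq_sym tkN.
have [| |km|[]|[Wk Xb Gb]] := IH.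
- by move=> j /andP[mj jk]; apply: t0; rewrite mj ltnW.
- by move=> j /andP[mj jk]; apply: Xx; rewrite mj ltnW.
- by apply: Z => [|i|]; rewrite /W big_geq.
- exact: Z.
have WS0 : 0 < W k.+1 by rewrite WS ltr_pwDl.
pose t := W k / W k.+1.
have t01 : 0 <= t <= 1.
  by rewrite divr_ge0 ?(ltW Wk) ?(ltW WS0)//= ler_pdivrMr// mul1r WS lerDl.
have t1 : 1 - t = theta k / W k.+1.
  by rewrite /t WS; field; rewrite -WS gt_eqF.
have xbS : xb k.+1 = pt_lin t (xb k) (1 - t) (x k).
  apply: functional_extensionality_dep => i.
  rewrite /xb /pt_lin t1 big_nat_recr//= scalerDr !scalerA; congr (_ *: _ + _ *: _).
    by rewrite /t mulrAC divff ?gt_eqF// mul1r.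
  by rewrite mulrC.
constructor 3; split=> //; first by rewrite xbS; apply: in_blocks_lin.
rewrite big_nat_recr//=; apply: le_trans (lerD Gb (lexx _)).
have := gap_convex Xb Xk t01; rewrite -xbS -(ler_pM2l WS0) => /le_trans; apply.
have Wt : W k.+1 * t = W k by rewrite mulrC divfK ?gt_eqF.
have Wt1 : W k.+1 * (1 - t) = theta k by rewrite t1 mulrC divfK ?gt_eqF.
by rewrite mulrDr (mulrA _ t) (mulrA _ (1 - t)) Wt Wt1.
Qed.

End descent_step.

(** * Measurability from continuity relative to finitely many coordinates *)

Section measurable_along.
Local Set Implicit Arguments.
Local Unset Strict Implicit.
Context d {T : measurableType d} {R : realType}.

(* The superlevel sets of h are countable unions of preimages of boxes with rational corners. *)
Lemma measurable_along (D : set T) (J : finType) (c : J -> T -> R) (h : T -> R) :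
  (forall j, measurable_fun D (c j)) ->
  (forall x, D x -> forall e : R, 0 < e -> exists2 r : R, 0 < r &
     forall y, D y -> (forall j, `|c j y - c j x| < r) -> `|h y - h x| < e) ->
  measurable_fun D h.
Proof.
move=> mc hc mD; apply: (measurability _ (RGenOInfty.measurableE R)) => //.
move=> /= _ [_ [a ->] <-].
pose box (kz : nat * {ffun J -> int}) : set T :=
  D `&` \bigcap_(j in [set: J])
    (* Cells of the grid of mesh [1/(k+1)], indexed by their integer corners; [F] keeps a cell only
       if [h > a] throughout it. *)
    (D `&` c j @^-1` `[(kz.2 j)%:~R / kz.1.+1%:R, (kz.2 j + 1)%:~R / kz.1.+1%:R[%classic).
pose F kz := if `[< forall y, box kz y -> a < h y >] then box kz else set0.
have -> : D `&` h @^-1` `]a, +oo[ = \bigcup_kz F kz.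
  apply/seteqP; split=> [x [Dx]|x [kz _]]; last first.
    rewrite /F; case: asboolP => // H bx; have [Dx _] := bx.
    by split=> //=; rewrite in_itv/= andbT; exact: H.
  rewrite /= in_itv/= andbT => ahx.
  have hxa : 0 < h x - a by rewrite subr_gt0.
  have [r r0 hr] := hc x Dx _ hxa.
  pose k := Num.truncn r^-1; have k0 : 0 < k.+1%:R :> R by rewrite ltr0Sn.
  have kr : k.+1%:R^-1 < r by rewrite invf_plt ?posrE// truncnS_gt.
  pose z := [ffun j => Num.floor (k.+1%:R * c j x)].
  have bx : box (k, z) x.
    split=> // j _; split=> //=; rewrite in_itv/= ffunE.
    by rewrite ler_pdivrMr// ltr_pdivlMr// mulrC floor_le//= floorD1_gt.
  exists (k, z) => //; rewrite /F asboolT// => y by_.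
  have same_box (q p s t : R) : q <= s -> s < q + p -> q <= t -> t < q + p -> `|t - s| <= p.
    by move=> *; rewrite ler_norml; apply/andP; split; lra.
  have [Dy _] := by_; have : `|h y - h x| < h x - a.
    apply: hr => // j; apply: le_lt_trans kr.
    have [_ ] := by_.2 j I; have [_] := bx.2 j I.
    rewrite /= !in_itv/= ffunE !intrD !mulrDl !mulr1z !mul1r => /andP[x1 x2] /andP[y1 y2].
    exact: same_box x1 x2 y1 y2.
  by rewrite ltr_norml => /andP[]; lra.
apply: countable_bigcupT_measurable; first exact: countableP.
move=> kz; rewrite /F; case: ifP => _; last exact: measurable0.
apply: measurableI => //; apply: fin_bigcap_measurable; first exact: finite_finset.
by move=> j _; apply: mc => //; exact: measurable_itv.
Qed.

End measurable_along.

(** * Continuity of the data of the problem *)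

Section norm_continuous.
Local Set Implicit Arguments.
Local Unset Strict Implicit.
Context {R : realType}.

Definition norm_continuous_on {m} (A : set 'rV[R]_m) (h : 'rV[R]_m -> R) : Prop :=
  forall x, A x -> forall e : R, 0 < e -> exists2 r : R, 0 < r &
    forall y, A y -> `|y - x| < r -> `|h y - h x| < e.

Lemma norm_lt_coord m (v : 'rV[R]_m) (e : R) :
  0 < e -> (forall j, `|v 0 j| < e) -> `|v| < e.
Proof.
move=> e0 ve; rewrite [ltLHS]mx_normrE; apply/bigmax_ltP; split=> // -[i j] _ /=.
by rewrite (ord1 i).
Qed.

Lemma locally_lipschitz_continuous m (A : set 'rV[R]_m) h :
  (forall x, A x -> exists K r : R, [/\ 0 <= K, 0 < r &
     forall y, A y -> `|y - x| < r -> `|h y - h x| <= K * `|y - x|]) ->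
  norm_continuous_on A h.
Proof.
move=> H x Ax e e0; have [K [r [K0 r0 hr]]] := H x Ax.
have K1 : 0 < K + 1 by rewrite ltr_wpDl.
exists (Num.min r (e / (K + 1))); first by rewrite lt_min r0 divr_gt0.
move=> y Ay; rewrite lt_min => /andP[yr ye]; apply: (le_lt_trans (hr y Ay yr)).
rewrite ltr_pdivlMr// in ye; apply: le_lt_trans ye.
by rewrite mulrC ler_wpM2l// lerDl.
Qed.

Lemma dual_norm_continuous m (N : 'rV[R]_m -> R) : is_norm N ->
  norm_continuous_on setT (dual_norm N).
Proof.
move=> HN; apply: locally_lipschitz_continuous => x _.
have [K K0 HK] := dual_norm_dist HN.
exists K, 1; split; [exact: ltW|exact: ltr01|].
by move=> y _ _; exact: HK.
Qed.

Lemma gradient_on_continuous m (N : 'rV[R]_m -> R) A w dw : is_norm N ->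
  gradient_on N A w dw -> norm_continuous_on A w.
Proof.
move=> HN Hg; apply: locally_lipschitz_continuous => x Ax.
have [K K0 HK] := is_norm_upper HN; have [r r0 hr] := Hg x Ax 1 ltr01.
exists (m%:R * `|dw x| + K), (r / K); split; rewrite ?divr_gt0//.
  by rewrite addr_ge0 ?mulr_ge0// ltW.
move=> y Ay; rewrite ltr_pdivlMr// mulrC => yx.
have := hr y Ay (le_lt_trans (HK _) yx).
have := dotv_le (dw x) (y - x); have := HK (y - x).
rewrite mul1r mulrDl => h1 h2 h3.
have -> : w y - w x = (w y - w x - dotv (dw x) (y - x)) + dotv (dw x) (y - x) by ring.
by apply: (le_trans (ler_normD _ _)); rewrite addrC lerD// (le_trans h3).
Qed.

Lemma within_continuous_coord m k (A : set 'rV[R]_m) (h : 'rV[R]_m -> 'rV[R]_k) j :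
  {within A, continuous h} -> norm_continuous_on A (fun x => h x 0 j).
Proof.
move=> /subspace_continuousP hc x Ax e e0.
have /nbhs_ballP[r /= r0 hr] : within A (nbhs x) (h @^-1` ball (h x) e).
  by apply: hc => //; apply/nbhs_ballP; exists e.
exists r => // y Ay yx; have : ball x r y.
  by rewrite mx_norm_ball /ball_ /= distrC.
move=> /hr /(_ Ay) /=; rewrite mx_norm_ball /ball_ /= distrC => /le_lt_trans; apply.
by apply: le_trans (coord_le_norm (h y - h x) j); rewrite !mxE.
Qed.

(** Convexity bounds [chi] above along each axis, midpoints combine the axes into a bound on a cube,
    and reflection through [x] turns the upper bound into a lower one. *)
Lemma convex_continuous m (chi : 'rV[R]_m -> R) :
  convex_fun_on setT chi -> norm_continuous_on setT chi.
Proof.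
move=> cchi; apply: locally_lipschitz_continuous => x _.
have ray (e : 'rV[R]_m) : exists2 M : R, 0 <= M & forall s, `|s| <= 1 ->
    chi (x + s *: e) - chi x <= M * `|s|.
  exists (`|chi (x + e) - chi x| + `|chi (x - e) - chi x|) => [|s s1].
    by rewrite addr_ge0.
  have aux (e' : 'rV[R]_m) (a : R) : 0 <= a -> a <= 1 ->
      chi (x + a *: e') - chi x <= `|chi (x + e') - chi x| * a.
    move=> a0 a1; have -> : x + a *: e' = a *: (x + e') + (1 - a) *: x.
      by apply/rowP => j; rewrite !mxE; ring.
    have := @cchi (x + e') x a I I; rewrite a0 a1 => /(_ isT).
    have : (chi (x + e') - chi x) * a <= `|chi (x + e') - chi x| * a.
      by rewrite ler_wpM2r// ler_norm.
    lra.
  rewrite mulrDl; have [s0|s0] := leP 0 s.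
    rewrite ger0_norm// in s1 *.
    by apply: (le_trans (aux _ _ s0 s1)); rewrite lerDl mulr_ge0.
  rewrite ltr0_norm// in s1 *; have -> : s *: e = (- s) *: (- e).
    by rewrite scalerN scaleNr opprK.
  by apply: (le_trans (aux _ _ _ s1)); rewrite ?oppr_ge0 ?(ltW s0)// lerDr mulr_ge0// oppr_ge0 ltW.
(* Adding an axis uses that [x + t e + S] is the midpoint of [x + 2 t e] and [x + 2 S]; hence
   constants add and the radius is halved. *)
have above (s : seq 'I_m) : exists C r : R, [/\ 0 <= C, 0 < r &
    forall (t : 'I_m -> R) (tau : R), tau <= r -> (forall j, `|t j| <= tau) ->
      chi (x + \sum_(j <- s) t j *: delta_mx 0 j) - chi x <= C * tau].
  elim: s => [|j s [C [r [C0 r0 IH]]]].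
    by exists 0, 1; split=> // t tau _ _; rewrite big_nil addr0 subrr mul0r.
  have [M M0 HM] := ray (delta_mx 0 j).
  exists (C + M), (Num.min r 1 / 2); split; rewrite ?addr_ge0 ?divr_gt0 ?lt_min ?r0 ?ltr01//.
  move=> t tau; rewrite ler_pdivlMr// le_min mulrC => /andP[taur tau1] tt.
  have tt2 i : `|2 * t i| <= 2 * tau by rewrite normrM ger0_norm// ler_pM2l.
  have := IH (fun i => 2 * t i) _ taur tt2.
  have := HM (2 * t j) (le_trans (tt2 j) tau1).
  have : M * `|2 * t j| <= M * (2 * tau) by rewrite ler_wpM2l.
  rewrite big_cons.
  have := @cchi (x + (2 * t j) *: delta_mx 0 j)
    (x + \sum_(j <- s) (2 * t j) *: delta_mx 0 j) 2^-1 I I.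
  have -> : \sum_(j <- s) (2 * t j) *: delta_mx 0 j =
      2 *: \sum_(j <- s) t j *: delta_mx 0 j :> 'rV[R]_m.
    by rewrite scaler_sumr; apply: eq_bigr => i _; rewrite scalerA.
  have h01 : 0 <= (2^-1 : R) <= 1 by apply/andP; split; lra.
  move=> /(_ h01); move: (\sum_(j <- s) _) => S.
  have -> : 2^-1 *: (x + (2 * t j) *: delta_mx 0 j) + (1 - 2^-1) *: (x + 2 *: S) =
      x + (t j *: delta_mx 0 j + S).
    by apply/rowP => i; rewrite !mxE; lra.
  rewrite mulrDl; lra.
have [C [r [C0 r0 H]]] := above (index_enum 'I_m).
exists C, r; split=> // y _ yx.
have Hv (v : 'rV[R]_m) : `|v| < r -> chi (x + v) - chi x <= C * `|v|.
  move=> vr; rewrite {1}(row_sum_delta v); apply: H => [|j]; first exact: ltW.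
  exact: coord_le_norm.
have h1 := Hv _ yx; have := Hv (- (y - x)); rewrite normrN => /(_ yx).
rewrite (addrC x) subrK in h1; move=> h2.
have h01 : 0 <= (2^-1 : R) <= 1 by apply/andP; split; lra.
have := @cchi y (x - (y - x)) _ I I h01.
have -> : 2^-1 *: y + (1 - 2^-1) *: (x - (y - x)) = x.
  by apply/rowP => i; rewrite !mxE; lra.
move=> h3; rewrite ler_norml; apply/andP; split => //; lra.
Qed.

End norm_continuous.

(** * Measurability of functions of random points *)

Section measurable_points.
Local Set Implicit Arguments.
Local Unset Strict Implicit.
Context d {T : measurableType d} {R : realType}.

Lemma measurable_comp_rv m (D : set T) (A : set 'rV[R]_m) h (y : T -> 'rV[R]_m) :
  norm_continuous_on A h -> (forall t, D t -> A (y t)) ->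
  (forall j, measurable_fun D (fun t => y t 0 j)) ->
  measurable_fun D (fun t => h (y t)).
Proof.
move=> hc DA ym; apply: (measurable_along ym) => x Dx e e0.
have [r r0 hr] := hc _ (DA _ Dx) e e0; exists r => // z Dz zx.
apply: hr; first exact: DA.
by apply: norm_lt_coord => // j; rewrite !mxE.
Qed.

Lemma measurable_comp_pt b (n : 'I_b -> nat) (D : set T)
    (X : forall i, set 'rV[R]_(n i)) (nrm : forall i, 'rV[R]_(n i) -> R) f g
    (y : T -> pt R n) :
  (forall i, is_norm (nrm i)) -> gradient_pt nrm X f g ->
  (forall t, D t -> in_blocks X (y t)) ->
  (forall i j, measurable_fun D (fun t => y t i 0 j)) ->
  measurable_fun D (fun t => f (y t)).
Proof.
move=> Hn Hg DX ym.
apply: (@measurable_along _ _ _ D {i : 'I_b & 'I_(n i)}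
  (fun ij t => y t (tag ij) 0 (tagged ij))) => [[i j]|x Dx e e0]; first exact: ym.
have [K K0 HK] : exists2 K : R, 0 < K & forall i v, nrm i v <= K * `|v|.
  have /choice[k Hk] i : exists K : R, 0 < K /\ forall v, nrm i v <= K * `|v|.
    by have [K ? ?] := is_norm_upper (Hn i); exists K.
  exists (1 + \sum_i k i) => [|i v].
    by rewrite ltr_pwDl// sumr_ge0// => i _; rewrite ltW// (Hk i).1.
  apply: (le_trans ((Hk i).2 v)); rewrite ler_wpM2r// (bigD1 i)//= addrCA lerDl.
  by rewrite addr_ge0// sumr_ge0// => j _; rewrite ltW// (Hk j).1.
have [r r0 hr] := Hg _ (DX _ Dx) 1 ltr01.
pose S : R := \sum_i (n i)%:R * `|g (y x) i|.
have S0 : 0 <= S by apply: sumr_ge0 => i _; rewrite mulr_ge0.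
pose B : R := b%:R * K + 1; have B0 : 0 < B by rewrite ltr_wpDl// mulr_ge0// ltW.
(* [S] controls the linear term and [B] strictly dominates the factor relating [pt_norm] to the
   coordinates; the two entries ensure closeness within [r] and a total change below [e]. *)
pose r' := Num.min (r / B) (e / (S + B)).
have SB : 0 < S + B by rewrite ltr_wpDl.
have r'0 : 0 < r' by rewrite lt_min !divr_gt0.
exists r' => // z Dz zx.
have zxi i : `|y z i - y x i| < r'.
  by apply: norm_lt_coord => // j; have := zx (Tagged _ j); rewrite !mxE.
have zN : pt_norm nrm (pt_lin 1 (y z) (-1) (y x)) <= r' * (b%:R * K).
  rewrite pt_norm_sub mulrCA mulr_natl -[X in _ *+ X](card_ord b) -sumr_const.
  apply: ler_sum => i _; apply: (le_trans (HK _ _)).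
  by rewrite mulrC ler_wpM2r ?ltW// ltW.
have zD : `|pt_dot (g (y x)) (pt_lin 1 (y z) (-1) (y x))| <= r' * S.
  rewrite pt_dot_sub; apply: (le_trans (ler_norm_sum _ _ _)); rewrite mulr_sumr.
  apply: ler_sum => i _; apply: (le_trans (dotv_le _ _)).
  by rewrite mulrC ler_wpM2r ?mulr_ge0// ltW.
have rB : r' * (b%:R * K) < r.
  have : r' * B <= r by rewrite -ler_pdivlMr// ge_min lexx.
  by apply: lt_le_trans; rewrite ltr_pM2l// /B ltrDl.
have := hr _ (DX _ Dz) (le_lt_trans zN rB); rewrite mul1r => h1.
rewrite -[f (y z) - f (y x)](subrK (pt_dot (g (y x)) (pt_lin 1 (y z) (-1) (y x)))).
apply: (le_lt_trans (ler_normD _ _)).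
apply: (le_lt_trans (lerD (le_trans h1 zN) zD)).
have : r' * (S + B) <= e by rewrite -ler_pdivlMr// ge_min lexx orbT.
by apply: lt_le_trans; rewrite -mulrDr ltr_pM2l// addrC ltrD2l /B ltrDl.
Qed.

End measurable_points.

(** * Integration over a fresh draw independent of the past *)

Section independent_step.
Local Set Implicit Arguments.
Local Unset Strict Implicit.
Local Open Scope ereal_scope.
Context {R : realType} {b : nat} {dO dT dX : measure_display}.
Context {Omega : measurableType dO} {T : measurableType dT} {Xi : measurableType dX}.
Variables (P : probability Omega R) (Q : probability T R) (mu : probability Xi R).
Variables (pi : Omega -> T) (xi : Omega -> Xi) (ik : Omega -> 'I_b).
Hypotheses (mpi : measurable_fun setT pi) (mxi : measurable_fun setT xi).
Hypothesis mik : forall i, measurable (ik @^-1` [set i]).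
Hypothesis indep : forall A B i, measurable A -> measurable B ->
  P (pi @^-1` A `&` xi @^-1` B `&` ik @^-1` [set i]) = b%:R^-1%:E * (Q A * mu B).

(** The image of [P], restricted to the event that [i] is drawn, under [(pi, xi)] is [1/b] times the
    product measure; Tonelli then iterates the integral. *)
Lemma integral_independent_step (i : 'I_b) (Phi : T * Xi -> \bar R) :
  measurable_fun setT Phi -> (forall p, 0 <= Phi p) ->
  \int[mrestr P (mik i)]_om Phi (pi om, xi om) =
  b%:R^-1%:E * \int[Q]_t \int[mu]_s Phi (t, s).
Proof.
move=> mPhi Phi0; pose psi om := (pi om, xi om).
have mpsi : measurable_fun setT psi by exact: measurable_fun_pair.
have [b0|b0] := ltnP 0 b; last by have := leq_trans (ltn_ord i) b0.
have bR : (b%:R != 0 :> R)%R by rewrite pnatr_eq0 -lt0n.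
pose cb : {nonneg R} := NngNum (ler0n R b).
have cV0 : (0 <= (b%:R^-1 : R))%R by rewrite invr_ge0.
pose cV : {nonneg R} := NngNum cV0.
pose m0 : {measure set (T * Xi) -> \bar R} := pushforward (mrestr P (mik i)) psi.
pose m' := m0 mpsi.
have m'E A : measurable A -> m' A = mscale cV (Q \x mu) A.
  (* Uniqueness of the product measure concerns the exact product rule, so the image is first
     multiplied by [b]. *)
  move=> mA; rewrite /mscale/= (@product_measure_unique _ _ _ _ _ Q mu (mscale cb m'))//.
    by rewrite /mscale/= muleA -EFinM mulVf// mul1e.
  move=> B C mB mC.
  transitivity (b%:R%:E * P (pi @^-1` B `&` xi @^-1` C `&` ik @^-1` [set i])) => //.
  by rewrite indep// muleA -EFinM divff// mul1e.
transitivity (\int[m']_p Phi p).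
  by rewrite ge0_integral_pushforward.
rewrite (eq_measure_integral (mscale cV (Q \x mu))); last by move=> A mA _; exact: m'E.
by rewrite ge0_integral_mscale// fubini_tonelli1.
Qed.

Lemma le_integral_independent_step (H : Omega -> \bar R) (Phi : 'I_b -> T * Xi -> \bar R) :
  measurable_fun setT H -> (forall om, 0 <= H om) ->
  (forall i, measurable_fun setT (Phi i)) -> (forall i p, 0 <= Phi i p) ->
  (forall om, H om <= Phi (ik om) (pi om, xi om)) ->
  \int[P]_om H om <= \sum_(i < b) b%:R^-1%:E * \int[Q]_t \int[mu]_s Phi i (t, s).
Proof.
move=> mH H0 mPhi Phi0 HPhi.
(* [msum] takes a sequence of measures over [nat], hence the zero measure beyond the indices of
   blocks. *)
pose m_ (k : nat) : {measure set Omega -> \bar R} :=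
  if insub k is Some i then mrestr P (mik i) else mzero.
have PE A : measurable A -> A `<=` setT -> P A = msum m_ b A.
  move=> mA _; rewrite /msum.
  rewrite (eq_bigr (fun i : 'I_b => P (A `&` ik @^-1` [set i]))); last first.
    by move=> i _; rewrite /m_ valK.
  rewrite -measure_bigsetU_ord//.
  - congr (P _); apply/seteqP; split=> [om Aom|om].
      by rewrite -bigcup_seq; exists (ik om) => //=; exact: mem_index_enum.
    by rewrite -bigcup_seq => -[i _ []].
  - by move=> i; exact: measurableI.
  - by apply/trivIsetP => i j _ _ ij; rewrite -subset0 => om [[_ /= ->] [_ /= ]] /eqP; exact/negP.
rewrite (eq_measure_integral (msum m_ b))// ge0_integral_measure_sum//.
apply: lee_sum => i _; rewrite -(@integral_independent_step i (Phi i))// /m_ valK.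
have mpsi : measurable_fun setT (fun om => (pi om, xi om)) by exact: measurable_fun_pair.
(* The domination by [Phi i] holds where [i] is drawn; the complement is null for the restricted
   measure. *)
apply: ae_ge0_le_integral => //; first exact: measurableT_comp.
exists (~` (ik @^-1` [set i])); split; first exact: measurableC.
  by rewrite /= /mrestr setICl measure0.
move=> om /= nle ikom; apply: nle => _; rewrite -ikom; exact: HPhi.
Qed.

End independent_step.

(** * The past before step [k] as a sigma-algebra *)

Section history.
Local Set Implicit Arguments.
Local Unset Strict Implicit.
Context {R : realType} {b : nat} {dO dX : measure_display}.
Context {Omega : measurableType dO} {Xi : measurableType dX}.
Variables (P : probability Omega R) (mu : probability Xi R).
Variables (xi : nat -> Omega -> Xi) (ik : nat -> Omega -> 'I_b).
Hypothesis Hxim : forall k, (1 <= k)%N -> measurable_fun setT (xi k).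
Hypothesis Hikm : forall k, (1 <= k)%N -> forall S : set 'I_b, measurable (ik k @^-1` S).
Hypothesis Hxidist : forall k, (1 <= k)%N -> forall A, measurable A ->
  P (xi k @^-1` A) = mu A.
Hypothesis Hikdist : forall k, (1 <= k)%N -> forall i,
  P (ik k @^-1` [set i]) = (b%:R^-1)%:E.
Hypothesis Hindep : mutually_independent P xi ik.

Definition history_event (A : nat -> set Xi) (S : nat -> set 'I_b) (k : nat) : set Omega :=
  \big[setI/setT]_(1 <= j < k) (xi j @^-1` A j `&` ik j @^-1` S j).

Definition history_gen (k : nat) : set (set Omega) :=
  [set E | exists A S, (forall j, measurable (A j)) /\ E = history_event A S k].

(** The carrier stays [Omega], so the projection to the past is the identity and an iterate is a
    function on the past as it stands. Only draws [1] to [k - 1] are seen. *)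
Definition history (k : nat) := g_sigma_algebraType (history_gen k).
HB.instance Definition _ k := Measurable.on (history k).

Lemma history_eventP A S k om :
  history_event A S k om <-> forall j, (1 <= j < k)%N -> A j (xi j om) /\ S j (ik j om).
Proof.
elim: k => [|k IH].
  by rewrite /history_event big_geq//; split=> // _ j; rewrite ltn0 andbF.
have [k0|k1] := leqP k 0.
  rewrite /history_event big_geq//; split=> // _ j /andP[j1].
  by rewrite ltnS => /(leq_trans j1) /leq_trans /(_ k0).
rewrite /history_event big_nat_recr//=; split=> [[/IH H Hk] j|H].
  rewrite ltnS => /andP[j1]; rewrite leq_eqVlt => /predU1P[->//|jk].
  by apply: H; rewrite j1.
split; last by apply: H; rewrite k1 ltnSn.
by apply/IH => j /andP[j1 jk]; apply: H; rewrite j1 ltnW.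
Qed.

Lemma history_gen_measurable k E : history_gen k E -> measurable E.
Proof.
move=> [A [S [mA ->]]]; rewrite /history_event big_nat.
apply: bigsetI_measurable => j /andP[j1 _]; apply: measurableI; last exact: Hikm.
by rewrite -[X in measurable X]setTI; apply: Hxim.
Qed.

Lemma measurable_fun_history k : measurable_fun setT (id : Omega -> history k).
Proof.
apply: (@measurability _ _ Omega (history k) setT id (history_gen k) erefl) => _ [E Ek <-].
by rewrite setTI preimage_id; exact: history_gen_measurable Ek.
Qed.

Lemma history_setI_closed k : setI_closed (history_gen k).
Proof.
move=> _ _ [A [S [mA ->]]] [A' [S' [mA' ->]]].
exists (fun j => A j `&` A' j), (fun j => S j `&` S' j); split.
  by move=> j; exact: measurableI.
apply/seteqP; split=> om.
  move=> [/history_eventP H /history_eventP H']; apply/history_eventP => j jk.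
  by have [? ?] := H j jk; have [? ?] := H' j jk.
by move=> /history_eventP H; split; apply/history_eventP => j /H [[? ?] [? ?]].
Qed.

Lemma measurable_history_xi k j : (1 <= j < k)%N ->
  measurable_fun setT (xi j : history k -> Xi).
Proof.
move=> jk _ B mB; rewrite setTI; apply: sub_sigma_algebra.
exists (fun l => if l == j then B else setT), (fun=> setT); split.
  by move=> l; case: ifP.
apply/seteqP; split=> om; last by move=> /history_eventP /(_ j jk); rewrite eqxx => -[].
by move=> Bom; apply/history_eventP => l _; split=> //; case: eqP => // ->.
Qed.

Lemma measurable_history_ik k j (S : set 'I_b) : (1 <= j < k)%N ->
  measurable (ik j @^-1` S : set (history k)).
Proof.
move=> jk; apply: sub_sigma_algebra.
exists (fun=> setT), (fun l => if l == j then S else setT); split=> //.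
apply/seteqP; split=> om; last by move=> /history_eventP /(_ j jk); rewrite eqxx => -[].
by move=> Bom; apply/history_eventP => l _; split=> //; case: eqP => // ->.
Qed.

Lemma measurable_historyS k : measurable_fun setT (id : history k.+1 -> history k).
Proof.
apply: (@measurability _ _ (history k.+1) (history k) setT id (history_gen k) erefl) => _ [_ [A [S [mA ->]]] <-].
rewrite setTI preimage_id; apply: sub_sigma_algebra.
exists (fun j => if (j < k)%N then A j else setT),
  (fun j => if (j < k)%N then S j else setT); split.
  by move=> j; case: ifP.
apply/seteqP; split=> om /history_eventP H; apply/history_eventP => j /andP[j1 jk].
  by case: ifP => // jk'; apply: H; rewrite j1.
by have := H j; rewrite j1 jk ltnW//= => /(_ isT).
Qed.

Definition history_mfun k : {mfun Omega >-> history k} :=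
  HB.pack (id : Omega -> history k)
    (isMeasurableFun.Build _ _ _ _ _ (@measurable_fun_history k)).

(** The restriction of [P] to the coarser sigma-algebra. *)
Definition history_law k : probability (history k) R := distribution P (history_mfun k).

Lemma integral_history_law k (h : Omega -> \bar R) :
  measurable_fun setT (h : history k -> \bar R) -> (forall om, (0 <= h om)%E) ->
  (\int[history_law k]_om h om = \int[P]_om h om)%E.
Proof.
move=> mh h0; rewrite (ge0_integral_pushforward (@measurable_fun_history k))//.
Qed.

(** As functions of [A] both sides are finite measures. They agree on the cylinder events, a
    pi-system containing the whole space, and hence everywhere. *)
Lemma history_indep k (A : set (history k)) (B : set Xi) i : (1 <= k)%N ->
  measurable A -> measurable B ->
  P ((id : Omega -> history k) @^-1` A `&` xi k @^-1` B `&` ik k @^-1` [set i]) =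
  (b%:R^-1%:E * (history_law k A * mu B))%E.
Proof.
move=> k1 mA mB.
have mC : measurable (xi k @^-1` B `&` ik k @^-1` [set i]).
  apply: measurableI; last exact: Hikm.
  by rewrite -[X in measurable X]setTI; exact: Hxim.
have bV0 : 0 <= b%:R^-1 :> R by rewrite invr_ge0.
have mu0 : 0 <= fine (mu B) by rewrite fine_ge0.
pose c : {nonneg R} := NngNum (mulr_ge0 bV0 mu0).
have cE : (c%:num%:E = b%:R^-1%:E * mu B)%E.
  by rewrite /= EFinM fineK// fin_num_measure.
pose m0 : {measure set (history k) -> \bar R} :=
  pushforward (mrestr P mC) (id : Omega -> history k).
pose m1 := m0 (@measurable_fun_history k).
have := @measure_unique _ R (history k) (history_gen k) (fun=> setT) erefl
  (@history_setI_closed k) _ _ m1 (mscale c (history_law k)).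
move=> H; transitivity (m1 A).
  by rewrite /m1 /= /pushforward /mrestr setIA.
rewrite H//.
- rewrite [LHS](_ : _ = c%:num%:E * history_law k A)%E//.
  by rewrite cE -muleA; congr (_ * _)%E; rewrite muleC.
- move=> _; exists (fun=> setT), (fun=> setT); split=> //.
  by apply/seteqP; split=> // om _; apply/history_eventP.
- by apply/seteqP; split=> // om _; exists 0%N.
- move=> E [A' [S' [mA' EE]]].
  transitivity (P (E `&` (xi k @^-1` B `&` ik k @^-1` [set i]))) => //.
  transitivity (c%:num%:E * P E)%E => //.
  (* The new event becomes coordinate [k] of a longer cylinder; independence at length [k.+1] splits
     it off, and at length [k] it reassembles the past. *)
  pose A2 j := if j == k then B else A' j.
  pose S2 j := if j == k then [set i] else S' j.
  have mA2 j : measurable (A2 j) by rewrite /A2; case: ifP.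
  have := @Hindep k.+1 A2 S2 mA2.
  have big_k (Rt : Type) (idx : Rt) op (F F' : nat -> Rt) :
      (forall j, j != k -> F j = F' j) ->
      \big[op/idx]_(1 <= j < k) F j = \big[op/idx]_(1 <= j < k) F' j.
    move=> FF'; rewrite !big_nat; apply: eq_bigr => j /andP[_ jk].
    by apply: FF'; rewrite ltn_eqF.
  rewrite !big_nat_recr//= /A2 /S2 !eqxx.
  rewrite (big_k _ _ _ _ (fun j => xi j @^-1` A' j `&` ik j @^-1` S' j)); last first.
    by move=> j /negbTE ->.
  rewrite (big_k _ _ _ _ (fun j => P (xi j @^-1` A' j) * P (ik j @^-1` S' j))%E); last first.
    by move=> j /negbTE ->.
  rewrite -(Hindep _ _ mA') -/(history_event A' S' k) -EE => ->.
  by rewrite Hxidist// Hikdist// cE muleC; congr (_ * _)%E; rewrite muleC.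
- move=> _; rewrite [ltLHS](_ : _ = P (xi k @^-1` B `&` ik k @^-1` [set i]))//.
    by rewrite ltey_eq fin_num_measure.
  by rewrite /m1 /= /pushforward /mrestr setTI.
Qed.

End history.

(** * Measurability of the oracle and of its mean *)

Section oracle.
Local Set Implicit Arguments.
Local Unset Strict Implicit.
Context {R : realType} {b : nat} {n : 'I_b -> nat}.
Context {dX : measure_display} {Xi : measurableType dX}.
Variables (G : pt R n -> Xi -> pt R n) (HGm : jointly_measurable G).

(** The sets with measurable preimage under [ys] form a sigma-algebra containing the generators
    [pt_Xi_gen]. *)
Lemma jointly_measurable_comp d (T : measurableType d) (y : T -> pt R n) (s : T -> Xi) :
  (forall i j, measurable_fun setT (fun t => y t i 0 j)) -> measurable_fun setT s ->
  forall i j, measurable_fun setT (fun t => G (y t) (s t) i 0 j).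
Proof.
move=> my ms i j _ B mB; rewrite setTI.
pose ys t := (y t, s t).
suff H : <<s @pt_Xi_gen R b n dX Xi >> `<=` [set S | measurable (ys @^-1` S)] by exact: (H _ (HGm j mB)).
apply: smallest_sub; last first.
  move=> _ [[i' [j' [B' [mB' ->]]]]|[A [mA ->]]] /=.
    by have := my i' j' measurableT B' mB'; rewrite setTI.
  by have := ms measurableT A mA; rewrite setTI.
split => /=.
- by rewrite preimage_set0.
- by move=> S mS; rewrite setTD preimage_setC; exact: measurableC.
- by move=> F mF; rewrite preimage_bigcup; exact: bigcupT_measurable.
Qed.

Variables (X : forall i, set 'rV[R]_(n i)) (mu : probability Xi R) (g : pt R n -> pt R n).
Hypothesis HG : forall x, in_blocks X x -> forall i (j : 'I_(n i)),
  mu.-integrable setT (fun s => (G x s i 0 j)%:E) /\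
  (\int[mu]_s (G x s i 0 j)%:E = (g x i 0 j)%:E)%E.

(** On feasible points [g] is the mean of [G]; Tonelli makes the integrals of the positive and
    negative parts measurable in the point. *)
Lemma measurable_mean_oracle d (T : measurableType d) (y : T -> pt R n) :
  (forall i j, measurable_fun setT (fun t => y t i 0 j)) ->
  (forall t, in_blocks X (y t)) ->
  forall i j, measurable_fun setT (fun t => g (y t) i 0 j).
Proof.
move=> my Xy i j; apply/measurable_EFinP.
pose h (p : T * Xi) : \bar R := (G (y p.1) p.2 i 0 j)%:E.
have mh : measurable_fun setT h.
  apply/measurable_EFinP; apply: (@jointly_measurable_comp _ _ (y \o fst) snd).
    by move=> i' j'; exact: (measurableT_comp (my i' j') measurable_fst).
  exact: measurable_snd.
have -> : EFin \o (fun t => g (y t) i 0 j) =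
    (fun t => \int[mu]_s (h^\+ (t, s)) - \int[mu]_s (h^\- (t, s)))%E.
  by apply/funext => t /=; rewrite -(HG (Xy t) j).2 integralE;
  congr (_ - _)%E; apply: eq_integral => s _; rewrite unlock.
apply: emeasurable_funB.
  exact: (measurable_fun_fubini_tonelli_F (h^\+)%E (measurable_funepos mh) (funepos_ge0 h)).
exact: (measurable_fun_fubini_tonelli_F (h^\-)%E (measurable_funeneg mh) (funeneg_ge0 h)).
Qed.

End oracle.

(** * Feasibility and measurability of the iterates *)

Section iterates.
Context {R : realType} {b : nat} {n : 'I_b -> nat} {dO dX : measure_display}.
Context {Omega : measurableType dO} {Xi : measurableType dX}.
Variables (X : forall i, set 'rV[R]_(n i)) (cX : forall i, convex_set_rv (X i)).
Variables (nrm : forall i, 'rV[R]_(n i) -> R) (Hnrm : forall i, is_norm (nrm i)).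
Variables (chi : forall i, 'rV[R]_(n i) -> R).
Hypothesis Hchi : forall i, convex_fun_on setT (chi i).
Variables (G : pt R n -> Xi -> pt R n) (HGm : jointly_measurable G).
Variables (w : forall i, 'rV[R]_(n i) -> R) (dw : forall i, 'rV[R]_(n i) -> 'rV[R]_(n i)).
Hypothesis Hdw : forall i, gradient_on (nrm i) (X i) (w i) (dw i).
Hypothesis Hdwc : forall i, {within X i, continuous (dw i)}.
Hypothesis Hsc : forall i, strongly_convex_on (nrm i) (X i) (w i).
Variables (xi : nat -> Omega -> Xi) (ik : nat -> Omega -> 'I_b).
Variables (gam : nat -> R) (Hgam : forall k, (1 <= k)%N -> 0 < gam k).
Variables (x1 : pt R n) (Hx1 : in_blocks X x1) (xs : nat -> Omega -> pt R n).
Hypothesis Hxs1 : forall om, xs 1%N om = x1.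
Hypothesis Hxs : forall k, (1 <= k)%N -> forall om,
  (forall j, j != ik k om -> xs k.+1 om j = xs k om j) /\
  is_prox (X (ik k om)) (w (ik k om)) (dw (ik k om)) (chi (ik k om))
    (xs k om (ik k om)) (G (xs k om) (xi k om) (ik k om)) (gam k)
    (xs k.+1 om (ik k om)).
Local Set Implicit Arguments.
Local Unset Strict Implicit.

Lemma iterate_in_blocks k om : (1 <= k)%N -> in_blocks X (xs k om).
Proof.
case: k => // k _; elim: k => [|k IH]; first by rewrite Hxs1.
have [xj px] := @Hxs k.+1 isT om.
by move=> i; have [->|/xj ->//] := eqVneq i (ik k.+1 om); exact: px.1.
Qed.

Lemma measurable_iterate k : (1 <= k)%N -> forall i j,
  measurable_fun setT ((fun om => xs k om i 0 j) : history xi ik k -> R).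
Proof.
case: k => // k _; elim: k => [|k IH] i j.
  have -> : (fun om => xs 1%N om i 0 j) = cst (x1 i 0 j) by apply/funext => om; rewrite Hxs1.
  exact: measurable_cst.
(* This history includes draw [k.+1], the one that produces [xs k.+2]. *)
pose T := history xi ik k.+2.
have mx i' j' : measurable_fun setT ((fun om => xs k.+1 om i' 0 j') : T -> R).
  exact: (measurableT_comp (IH i' j') (@measurable_historyS _ _ _ _ _ xi ik k.+1)).
have mxi : measurable_fun setT (xi k.+1 : T -> Xi).
  by apply: measurable_history_xi; rewrite ltnSn.
have mG := jointly_measurable_comp HGm mx mxi.
pose D : set T := ik k.+1 @^-1` [set i].
have mD : measurable D by apply: measurable_history_ik; rewrite ltnSn.
rewrite -(setUv D); apply/measurable_funU => //; first exact: measurableC.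
have Xk om : X i (xs k.+1 om i) by exact: iterate_in_blocks.
split; last first.
  have same : {in ~` D, (fun om => xs k.+1 om i 0 j) =1 (fun om => xs k.+2 om i 0 j)}.
    move=> om; rewrite inE => /= ikom; rewrite (proj1 (Hxs k.+1 isT om))//.
    by apply/eqP => iE; apply: ikom.
  exact: (eq_measurable_fun _ same (measurable_funTS (mx i j))).
have [K K0 HK] := prox_lipschitz (Hnrm i) (@cX i) (Hdw i) (Hsc i) (@Hchi i) (@Hgam k.+1 isT).
(* On the event that [i] is drawn, [prox_lipschitz] compares the new blocks of two outcomes through
   these coordinates alone. *)
pose c (l : 'I_(n i) + 'I_(n i)) (om : T) : R :=
  match l with
  | inl l => dw i (xs k.+1 om i) 0 l
  | inr l => G (xs k.+1 om) (xi k.+1 om) i 0 l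
  end.
apply: (@measurable_along _ _ _ D _ c) => [[l|l]|om Dom e e0].
- have cdw := within_continuous_coord l (Hdwc i).
  apply: (@measurable_comp_rv _ T R _ D (X i) (fun v => dw i v 0 l)
    (fun om => xs k.+1 om i) cdw) => [om _|l']; first exact: Xk.
  exact: measurable_funTS (mx i l').
- exact: measurable_funTS (mG i l).
pose r := e / (K * 2); have r0 : 0 < r by rewrite divr_gt0// mulr_gt0.
exists r => // om' Dom' close.
have px := (@Hxs k.+1 isT om).2; rewrite (Dom : ik k.+1 om = i) in px.
have px' := (@Hxs k.+1 isT om').2; rewrite (Dom' : ik k.+1 om' = i) in px'.
have := HK _ _ _ _ _ _ px' px (Xk _) (Xk _) => H.
have := coord_le_norm (xs k.+2 om' i - xs k.+2 om i) j; rewrite !mxE => /le_lt_trans; apply.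
apply: (le_lt_trans H).
have h1 : `|dw i (xs k.+1 om' i) - dw i (xs k.+1 om i)| < r.
  by apply: norm_lt_coord => // l; have := close (inl l); rewrite !mxE.
have h2 : `|G (xs k.+1 om') (xi k.+1 om') i - G (xs k.+1 om) (xi k.+1 om) i| < r.
  by apply: norm_lt_coord => // l; have := close (inr l); rewrite !mxE.
have -> : e = K * (r + r) by rewrite /r; field; rewrite gt_eqF.
by rewrite ltr_pM2l// ltrD.
Qed.

End iterates.

(** * Expectation of the step bound over one oracle draw *)

Section expected_step.
Context {R : realType} {b : nat} {n : 'I_b -> nat}.
Context {dX : measure_display} {Xi : measurableType dX}.
Variables (X : forall i, set 'rV[R]_(n i)) (cX : forall i, convex_set_rv (X i)).
Variables (nrm : forall i, 'rV[R]_(n i) -> R) (Hnrm : forall i, is_norm (nrm i)).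
Variables (f : pt R n -> R) (g : pt R n -> pt R n).
Hypotheses (Hfconv : convex_fun_pt X f) (Hgrad : gradient_pt nrm X f g).
Variables (L : 'I_b -> R).
Hypothesis HLip : forall i (x y : pt R n), in_blocks X x -> in_blocks X y ->
  (forall j, j != i -> y j = x j) ->
  dual_norm (nrm i) (g y i - g x i) <= L i * nrm i (y i - x i).
Variables (chi : forall i, 'rV[R]_(n i) -> R).
Hypothesis Hchi : forall i, convex_fun_on setT (chi i).
Variables (w : forall i, 'rV[R]_(n i) -> R) (dw : forall i, 'rV[R]_(n i) -> 'rV[R]_(n i)).
Hypothesis Hdw : forall i, gradient_on (nrm i) (X i) (w i) (dw i).
Hypothesis Hdwc : forall i, {within X i, continuous (dw i)}.
Hypothesis Hsc : forall i, strongly_convex_on (nrm i) (X i) (w i).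
Variables (u : pt R n) (Xu : in_blocks X u).
Hypothesis uopt : forall x, in_blocks X x -> phi_obj f chi u <= phi_obj f chi x.
Variables (mu : probability Xi R) (G : pt R n -> Xi -> pt R n).
Hypothesis HGm : jointly_measurable G.
Hypothesis HG : forall x, in_blocks X x -> forall i (j : 'I_(n i)),
  mu.-integrable setT (fun s => (G x s i 0 j)%:E) /\
  (\int[mu]_s (G x s i 0 j)%:E = (g x i 0 j)%:E)%E.
Variable sig : 'I_b -> R.
Hypothesis HGvar : forall x, in_blocks X x -> forall i,
  (\int[mu]_s ((dual_norm (nrm i) (G x s i - g x i)) ^+ 2)%:E <= (sig i ^+ 2)%:E)%E.

Local Notation gap := (gap f chi u).
Local Notation total_bregman := (total_bregman w dw u).
Local Notation step_bound := (step_bound nrm f g chi w dw u).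
Local Set Implicit Arguments.
Local Unset Strict Implicit.

Section measurability.
Context d {T : measurableType d}.
Variable y : T -> pt R n.
Hypothesis my : forall i j, measurable_fun setT (fun t => y t i 0 j).
Hypothesis Xy : forall t, in_blocks X (y t).

Lemma measurable_dotv m (p q : T -> 'rV[R]_m) :
  (forall j, measurable_fun setT (fun t => p t 0 j)) ->
  (forall j, measurable_fun setT (fun t => q t 0 j)) ->
  measurable_fun setT (fun t => dotv (p t) (q t)).
Proof. by move=> mp mq; apply: measurable_sum => j; exact: measurable_funM. Qed.

Lemma measurable_chi i : measurable_fun setT (fun t => chi i (y t i)).
Proof. by apply: (measurable_comp_rv (convex_continuous (@Hchi i))) => //; exact: my. Qed.

Lemma measurable_target_diff i j : measurable_fun setT (fun t => (u i - y t i) 0 j).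
Proof.
have -> : (fun t => (u i - y t i) 0 j) = (fun t => u i 0 j - y t i 0 j).
  by apply/funext => t; rewrite !mxE.
by apply: measurable_funB => //; exact: my.
Qed.

Lemma measurable_gap : measurable_fun setT (fun t => gap (y t)).
Proof.
apply: measurable_funB => //; apply: measurable_funD.
  exact: (measurable_comp_pt Hnrm Hgrad (fun t _ => Xy t) my).
by apply: measurable_sum => i; exact: measurable_chi.
Qed.

Lemma measurable_total_bregman : measurable_fun setT (fun t => total_bregman (y t)).
Proof.
apply: measurable_sum => i; apply: measurable_funB.
  apply: measurable_funB => //.
  by apply: (measurable_comp_rv (gradient_on_continuous (Hnrm i) (Hdw i)) (fun t _ => Xy t i)).
apply: measurable_dotv => j; last exact: measurable_target_diff.
apply: (@measurable_comp_rv _ T R _ setT (X i) (fun v => dw i v 0 j) (fun t => y t i)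
  (within_continuous_coord j (Hdwc i))) => [t _|l]; first exact: Xy.
exact: my.
Qed.

Lemma measurable_noise (s : T -> Xi) i : measurable_fun setT s ->
  measurable_fun setT (fun t => dual_norm (nrm i) (G (y t) (s t) i - g (y t) i)).
Proof.
move=> ms; apply: (@measurable_comp_rv _ T R _ setT setT _
  (fun t => G (y t) (s t) i - g (y t) i) (dual_norm_continuous (Hnrm i))) => // j.
have -> : (fun t => (G (y t) (s t) i - g (y t) i) 0 j) =
    (fun t => G (y t) (s t) i 0 j - g (y t) i 0 j).
  by apply/funext => t; rewrite !mxE.
apply: measurable_funB; first exact: jointly_measurable_comp.
exact: (measurable_mean_oracle HGm HG).
Qed.

Lemma measurable_step_bound (s : T -> Xi) gm i : measurable_fun setT s ->
  measurable_fun setT (fun t => step_bound gm i (y t) (G (y t) (s t))).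
Proof.
move=> ms; apply: measurable_funD; first apply: measurable_funD; first apply: measurable_funD.
- by apply: measurable_funM => //; exact: measurable_total_bregman.
- by apply: measurable_funM => //; exact: measurable_gap.
- apply: measurable_funM => //; apply: measurable_funB; last exact: measurable_chi.
  apply: measurable_funD => //; apply: measurable_dotv => j.
    exact: jointly_measurable_comp.
  exact: measurable_target_diff.
- apply: measurable_funM => //; apply: measurable_funX; exact: measurable_noise.
Qed.

End measurability.

(** At a fixed point the linear term is integrable by [HG] and the square by [HGvar]; the integral
    is then exact except for the variance bound. *)
Lemma integral_step_bound gm i x : 0 < gm -> in_blocks X x ->
  (\int[mu]_s (step_bound gm i x (G x s))%:E <=
   (b%:R * total_bregman x + b%:R * gm * gap x
    + b%:R * gm * (dotv (g x i) (u i - x i) + chi i (u i) - chi i (x i))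
    + b%:R * gm ^+ 2 * sig i ^+ 2)%:E)%E.
Proof.
move=> g0 Xx; set c1 := b%:R * gm; set c2 := b%:R * gm ^+ 2.
have c20 : 0 <= c2 by rewrite mulr_ge0// sqr_ge0.
pose lin s := dotv (G x s i) (u i - x i).
pose sq s := dual_norm (nrm i) (G x s i - g x i) ^+ 2.
have linE : EFin \o lin =
    (fun s => \sum_(j < n i) ((G x s i 0 j)%:E * ((u i - x i) 0 j)%:E))%E.
  by apply/funext => s; rewrite /= /lin /dotv -sumEFin; apply: eq_bigr.
have iG j : mu.-integrable setT (fun s => (G x s i 0 j)%:E * ((u i - x i) 0 j)%:E)%E.
  exact: integrableZr (HG _ Xx _ j).1.
have ilin : mu.-integrable setT (EFin \o lin) by rewrite linE; exact: integrable_sum.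
have Ilin : (\int[mu]_s (lin s)%:E = (dotv (g x i) (u i - x i))%:E)%E.
  transitivity (\int[mu]_s (EFin \o lin) s)%E => //.
  rewrite linE integral_sum// /dotv -sumEFin; apply: eq_bigr => j _.
  by rewrite integralZr ?(HG _ Xx _ j).2// (HG _ Xx _ j).1.
have mx i' (j : 'I_(n i')) : measurable_fun setT (fun _ : Xi => x i' 0 j) by [].
have msq : measurable_fun setT sq.
  apply: measurable_funX.
  exact: (@measurable_noise _ Xi (fun=> x) mx (fun=> Xx) id i (@measurable_id _ _ _)).
have sq0 s : (0 <= (sq s)%:E)%E by rewrite lee_fin sqr_ge0.
have isq : mu.-integrable setT (EFin \o sq).
  apply/integrableP; split; first exact/measurable_EFinP.
  under eq_integral => s _ do rewrite gee0_abs//=.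
  by apply: (le_lt_trans (HGvar _ Xx i)); rewrite ltry.
pose a := b%:R * total_bregman x + c1 * gap x + c1 * (chi i (u i) - chi i (x i)).
have -> : (fun s => (step_bound gm i x (G x s))%:E) =
    (fun s => (EFin \o cst a) s + (c1%:E * (EFin \o lin) s + c2%:E * (EFin \o sq) s))%E.
  apply/funext => s; rewrite /= -!EFinM -!EFinD; congr (_%:E).
  by rewrite /step_bound /a /lin /sq -/c1 -/c2; ring.
have ic1 := integrableZl measurableT c1 ilin.
have ic2 := integrableZl measurableT c2 isq.
rewrite integralD//=; last 2 first.
- exact: finite_measure_integrable_cst.
- exact: integrableD.
rewrite integralD// !integralZl// integral_cst//.
rewrite [X in (_ * X + _)%E](_ : _ = 1%E); last exact: probability_setT.
rewrite mule1 Ilin.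
apply: (@le_trans _ _ (a%:E + (c1%:E * (dotv (g x i) (u i - x i))%:E + c2%:E * (sig i ^+ 2)%:E))%E).
  by rewrite leeD2l// leeD2l// lee_wpmul2l ?lee_fin//; exact: HGvar.
by rewrite -!EFinM -!EFinD lee_fin /a le_eqVlt; apply/orP; left; apply/eqP; ring.
Qed.

End expected_step.

(** * The convergence bound *)

Theorem theorem3p1
  (R : realType) (b : nat) (n : 'I_b -> nat) (hb : (0 < b)%N)
  (* feasible blocks X_i : nonempty, closed, convex *)
  (X : forall i, set 'rV[R]_(n i))
  (HX : forall i, [/\ X i !=set0, closed (X i) & convex_set_rv (X i)])
  (* block norms *)
  (nrm : forall i, 'rV[R]_(n i) -> R) (Hnrm : forall i, is_norm (nrm i))
  (* random data xi with law mu, f(x) = E[F(x,xi)] *)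
  (dXi : measure_display) (Xi : measurableType dXi) (mu : probability Xi R)
  (F : pt R n -> Xi -> R) (f : pt R n -> R) (g : pt R n -> pt R n)
  (HF : forall x, in_blocks X x ->
     mu.-integrable setT (fun s => (F x s)%:E) /\
     (\int[mu]_s (F x s)%:E = (f x)%:E)%E)
  (Hfconv : convex_fun_pt X f)
  (Hgrad : gradient_pt nrm X f g)
  (* block Lipschitz gradient *)
  (L : 'I_b -> R) (HL0 : forall i, 0 <= L i)
  (HLip : forall i (x y : pt R n), in_blocks X x -> in_blocks X y ->
     (forall j, j != i -> y j = x j) ->
     dual_norm (nrm i) (g y i - g x i) <= L i * nrm i (y i - x i))
  (* separable convex term chi *)
  (chi : forall i, 'rV[R]_(n i) -> R)
  (Hchi : forall i, convex_fun_on setT (chi i))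
  (* stochastic oracle *)
  (G : pt R n -> Xi -> pt R n) (HGm : jointly_measurable G)
  (sig : 'I_b -> R)
  (HG : forall x, in_blocks X x -> forall i (j : 'I_(n i)),
     mu.-integrable setT (fun s => (G x s i 0 j)%:E) /\
     (\int[mu]_s (G x s i 0 j)%:E = (g x i 0 j)%:E)%E)
  (HGvar : forall x, in_blocks X x -> forall i,
     (\int[mu]_s ((dual_norm (nrm i) (G x s i - g x i)) ^+ 2)%:E
        <= (sig i ^+ 2)%:E)%E)
  (* prox setup *)
  (w : forall i, 'rV[R]_(n i) -> R) (dw : forall i, 'rV[R]_(n i) -> 'rV[R]_(n i))
  (Hw : forall i, [/\ gradient_on (nrm i) (X i) (w i) (dw i),
                      {within X i, continuous (dw i)} &
                      strongly_convex_on (nrm i) (X i) (w i)])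
  (* the random sequences xi_k, i_k on a probability space *)
  (dO : measure_display) (Omega : measurableType dO) (P : probability Omega R)
  (xi : nat -> Omega -> Xi) (ik : nat -> Omega -> 'I_b)
  (Hxim : forall k, (1 <= k)%N -> measurable_fun setT (xi k))
  (Hikm : forall k, (1 <= k)%N -> forall S : set 'I_b, measurable (ik k @^-1` S))
  (Hxidist : forall k, (1 <= k)%N -> forall A, measurable A ->
     P (xi k @^-1` A) = mu A)
  (Hikdist : forall k, (1 <= k)%N -> forall i,
     P (ik k @^-1` [set i]) = (b%:R^-1)%:E)
  (Hindep : mutually_independent P xi ik)
  (* stepsizes and weights *)
  (gam theta : nat -> R)
  (Hgam : forall k, (1 <= k)%N ->
     0 < gam k /\ 2 * (\big[Num.max/0]_(i < b) L i) * gam k <= 1)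
  (Htheta1 : theta 1%N = 0)
  (Htheta : forall k, (1 <= k)%N ->
     theta k.+1 = b%:R * gam k - (b%:R - 1) * gam k.+1)
  (* the composite SBMD iterates *)
  (x1 : pt R n) (Hx1 : in_blocks X x1)
  (xs : nat -> Omega -> pt R n)
  (Hxs1 : forall om, xs 1%N om = x1)
  (Hxs : forall k, (1 <= k)%N -> forall om,
     (forall j, j != ik k om -> xs k.+1 om j = xs k om j) /\
     is_prox (X (ik k om)) (w (ik k om)) (dw (ik k om)) (chi (ik k om))
       (xs k om (ik k om)) (G (xs k om) (xi k om) (ik k om)) (gam k)
       (xs k.+1 om (ik k om)))
  (* an optimal solution *)
  (xstar : pt R n)
  (Hxstar : in_blocks X xstar /\
     forall x, in_blocks X x -> phi_obj f chi xstar <= phi_obj f chi x)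
  (N : nat) (HN : (2 <= N)%N)
  (* x_bar_N is a weighted average: nonnegative weights, positive total *)
  (Hthetapos : forall k, (2 <= k <= N.+1)%N -> 0 <= theta k)
  (Hthetasum : 0 < \sum_(2 <= k < N.+2) theta k) :
  ('E_P[fun om => (
      phi_obj f chi
        (fun i => (\sum_(2 <= k < N.+2) theta k)^-1 *:
                  \sum_(2 <= k < N.+2) theta k *: xs k om i)
      - phi_obj f chi xstar)%R]
   <= ((\sum_(2 <= k < N.+2) theta k)^-1 *
       ((b%:R - 1) * gam 1%N * (phi_obj f chi x1 - phi_obj f chi xstar)
        + b%:R * \sum_(i < b) bregman (w i) (dw i) (x1 i) (xstar i)
        + (\sum_(i < b) sig i ^+ 2) * \sum_(1 <= k < N.+1) gam k ^+ 2))%:E)%E.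
Proof.
pose Gap := gap f chi xstar; pose TB := total_bregman w dw xstar.
pose S2 : R := \sum_i sig i ^+ 2.
have S20 : 0 <= S2 by apply: sumr_ge0 => i _; exact: sqr_ge0.
have [Xstar optstar] := Hxstar.
have cX i : convex_set_rv (X i) by case: (HX i).
have Hdw i : gradient_on (nrm i) (X i) (w i) (dw i) by case: (Hw i).
have Hdwc i : {within X i, continuous (dw i)} by case: (Hw i).
have Hsc i : strongly_convex_on (nrm i) (X i) (w i) by case: (Hw i).
have g0 k : (1 <= k)%N -> 0 < gam k by move=> /Hgam[].
have Lg i k : (1 <= k)%N -> 2 * L i * gam k <= 1.
  move=> k1; have [gk Lk] := Hgam k k1; apply: le_trans Lk.
  by rewrite ler_pM2r// ler_pM2l//; exact: le_bigmax.
have Xk k om : (1 <= k)%N -> in_blocks X (xs k om).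
  move=> k1; exact: (iterate_in_blocks Hx1 Hxs1 Hxs om k1).
have mx k : (1 <= k)%N -> forall i j,
    measurable_fun setT ((fun om => xs k om i 0 j) : history xi ik k -> R).
  move=> k1 i j; exact: (measurable_iterate cX Hnrm Hchi HGm Hdw Hdwc Hsc g0 Hx1 Hxs1 Hxs k1 j).
have mGapH k : (1 <= k)%N -> measurable_fun setT ((fun om => Gap (xs k om)) : history xi ik k -> R).
  move=> k1; exact: (measurable_gap Hnrm Hgrad Hchi xstar (mx k k1) (fun t => Xk k t k1)).
have mTBH k : (1 <= k)%N -> measurable_fun setT ((fun om => TB (xs k om)) : history xi ik k -> R).
  move=> k1; exact: (measurable_total_bregman Hnrm Hdw Hdwc xstar (mx k k1) (fun t => Xk k t k1)).
have mid k := @measurable_fun_history b dO dXi Omega Xi xi ik Hxim Hikm k.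
have mGap k : (1 <= k)%N -> measurable_fun setT (fun om => Gap (xs k om)).
  move=> k1; exact: (measurableT_comp (mGapH k k1) (mid k)).
have mTB k : (1 <= k)%N -> measurable_fun setT (fun om => TB (xs k om)).
  move=> k1; exact: (measurableT_comp (mTBH k k1) (mid k)).
have Gap0 k om : (1 <= k)%N -> 0 <= Gap (xs k om).
  by move=> k1; exact: (gap_ge0 optstar (Xk k om k1)).
have TB0 k om : (1 <= k)%N -> 0 <= TB (xs k om).
  by move=> k1; exact: (total_bregman_ge0 cX Hnrm Hdw Hsc Xstar (Xk k om k1)).
have b1 : 0 <= b%:R - 1 :> R by rewrite subr_ge0 ler1n.
(* Both integrals may a priori be infinite, so the inequality is kept free of subtraction. *)
have step k : (1 <= k)%N ->
  (\int[P]_om (b%:R * TB (xs k.+1 om) + b%:R * gam k * Gap (xs k.+1 om))%:E <=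
   \int[P]_om (b%:R * TB (xs k om) + (b%:R - 1) * gam k * Gap (xs k om))%:E
   + (gam k ^+ 2 * S2)%:E)%E.
  move=> k1.
  pose Q := history_law P Hxim Hikm k.
  pose Phi (i : 'I_b) (p : history xi ik k * Xi) : \bar R :=
    (step_bound nrm f g chi w dw xstar (gam k) i (xs k p.1) (G (xs k p.1) p.2))%:E.
  have mPhi i : measurable_fun setT (Phi i).
    apply/measurable_EFinP.
    have my i' j : measurable_fun setT (fun p : history xi ik k * Xi => xs k p.1 i' 0 j).
      exact: (measurableT_comp (mx k k1 i' j) measurable_fst).
    exact: (measurable_step_bound Hnrm Hgrad Hchi Hdw Hdwc xstar HGm HG my
      (fun p => Xk k p.1 k1) (gam k) i measurable_snd).
  have Phi0 i p : (0 <= Phi i p)%E.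
    rewrite lee_fin.
    exact: (step_bound_ge0 cX Hnrm Hfconv Hgrad HLip Hdw Hsc Xstar optstar _
      (g0 k k1) (Lg i k k1) (Xk k p.1 k1)).
  have mik i : measurable (ik k @^-1` [set i]) by exact: (Hikm k k1 [set i]).
  have ind A B i : measurable A -> measurable B -> _ :=
    @history_indep R b dO dXi Omega Xi P mu xi ik Hxim Hikm Hxidist Hikdist Hindep k A B i k1.
  have mTBS : measurable_fun setT
      (fun om => (b%:R * TB (xs k.+1 om) + b%:R * gam k * Gap (xs k.+1 om))%:E).
    apply/measurable_EFinP; apply: measurable_funD.
      by apply: measurable_funM => //; exact: mTB.
    by apply: measurable_funM => //; exact: mGap.
  apply: (le_trans (@le_integral_independent_step R b dO _ dXi Omega (history xi ik k) Xi
    P Q mu (id : Omega -> history xi ik k) (xi k) (ik k) (mid k) (Hxim k k1) mik ind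
    _ Phi mTBS _ mPhi Phi0 _)).
  - move=> om; rewrite lee_fin addr_ge0//.
      by rewrite mulr_ge0// TB0.
    by rewrite !mulr_ge0// ?Gap0// ltW// g0.
  - move=> om; rewrite lee_fin; have [x'x px] := Hxs k k1 om.
    exact: (step_boundP cX Hnrm Hfconv Hgrad HLip Hchi Hdw Hsc Xstar
      (g0 k k1) (Lg (ik k om) k k1) (Xk k om k1) x'x px).
  have mF i : measurable_fun setT (fun t => \int[mu]_s Phi i (t, s))%E.
    exact: measurable_fun_fubini_tonelli_F.
  have F0 i t : (0 <= \int[mu]_s Phi i (t, s))%E by exact: integral_ge0.
  have bV0 : 0 <= b%:R^-1 :> R by rewrite invr_ge0.
  under eq_bigr => i _ do rewrite -ge0_integralZl//.
  rewrite -ge0_integral_sum//; last 2 first.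
  - by move=> i; exact: measurable_funeM.
  - by move=> i t _; rewrite mule_ge0.
  pose B om := b%:R * TB (xs k om) + (b%:R - 1) * gam k * Gap (xs k om).
  have B0 om : 0 <= B om.
    rewrite addr_ge0//; first by rewrite mulr_ge0// TB0.
    by rewrite !mulr_ge0// ?Gap0// ltW// g0.
  have mBH : measurable_fun setT (B : history xi ik k -> R).
    apply: measurable_funD; first by apply: measurable_funM => //; exact: mTBH.
    by apply: measurable_funM => //; exact: mGapH.
  have c0 : 0 <= gam k ^+ 2 * S2 by rewrite mulr_ge0// sqr_ge0.
  apply: (@le_trans _ _ (\int[Q]_t ((B t)%:E + (gam k ^+ 2 * S2)%:E))%E).
    apply: ge0_le_integral => //.
    - by move=> t _; apply: sume_ge0 => i _; rewrite mule_ge0.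
    - by apply: emeasurable_sum => i; exact: measurable_funeM.
    - by apply: emeasurable_funD => //; exact/measurable_EFinP.
    move=> t _; have := step_bound_mean cX Hnrm Hfconv Hgrad chi w dw Xstar sig hb (g0 k k1) (Xk k t k1).
    rewrite -lee_fin -EFinD; apply: le_trans; rewrite -sumEFin; apply: lee_sum => i _.
    rewrite EFinM lee_wpmul2l ?lee_fin//.
    exact: (integral_step_bound Hnrm f chi w dw xstar HGm HG HGvar i (g0 k k1) (Xk k t k1)).
  have -> : (\int[Q]_t ((B t)%:E + (gam k ^+ 2 * S2)%:E) =
      \int[Q]_t (B t)%:E + (gam k ^+ 2 * S2)%:E)%E.
    rewrite (@ge0_integralD _ _ _ Q _ measurableT (EFin \o B) (cst (gam k ^+ 2 * S2)%:E))//.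
    - by rewrite integral_cst// [X in (_ * X)%E](_ : _ = 1%E) ?mule1//; exact: probability_setT.
    - by move=> t _; rewrite lee_fin.
    - exact/measurable_EFinP.
  rewrite leeD2r// (@integral_history_law _ _ _ _ _ _ P _ _ Hxim Hikm k (EFin \o B))//.
    exact/measurable_EFinP.
pose a k := (\int[P]_om (b%:R * TB (xs k om) + (b%:R - 1) * gam k * Gap (xs k om))%:E)%E.
pose e k := (\int[P]_om (Gap (xs k om))%:E)%E.
have B0 k om : (1 <= k)%N -> 0 <= b%:R * TB (xs k om) + (b%:R - 1) * gam k * Gap (xs k om).
  move=> k1; rewrite addr_ge0//; first by rewrite mulr_ge0// TB0.
  by rewrite !mulr_ge0// ?Gap0// ltW// g0.
(* Splitting the integral into nonnegative parts uses [0 <= theta k.+1], whence the range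
   [k <= N]. *)
have stepa k : (1 <= k <= N)%N ->
    (a k.+1 + (theta k.+1)%:E * e k.+1 <= a k + (gam k ^+ 2 * S2)%:E)%E.
  move=> /andP[k1 kN]; apply: le_trans (step k k1).
  have th0 : 0 <= theta k.+1 by apply: Hthetapos; rewrite !ltnS k1.
  have mGapE : measurable_fun setT (fun om => (Gap (xs k.+1 om))%:E).
    by apply/measurable_EFinP; exact: mGap.
  rewrite /a /e -ge0_integralZl//; last first.
    by move=> om _; rewrite lee_fin Gap0.
  rewrite -ge0_integralD//; last 4 first.
  - by move=> om _; rewrite lee_fin B0.
  - apply/measurable_EFinP; apply: measurable_funD.
      by apply: measurable_funM => //; exact: mTB.
    by apply: measurable_funM => //; exact: mGap.
  - by move=> om _; rewrite mule_ge0// lee_fin ?Gap0.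
  - exact: measurable_funeM.
  rewrite le_eqVlt; apply/orP; left; apply/eqP; apply: eq_integral => om _.
  by rewrite -EFinM -EFinD Htheta//; congr (_%:E); ring.
have tele m : (m <= N)%N ->
    (a m.+1 + \sum_(2 <= k < m.+2) (theta k)%:E * e k <=
     a 1%N + (S2 * \sum_(1 <= k < m.+1) gam k ^+ 2)%:E)%E.
  elim: m => [_|m IH mN]; first by rewrite !big_geq// mulr0 adde0.
  rewrite big_nat_recr//= addeCA.
  apply: (le_trans (leeD2l _ (stepa m.+1 mN))).
  rewrite addeA [X in (X + _)%E]addeC; apply: (le_trans (leeD2r _ (IH (ltnW mN)))).
  by rewrite -addeA -EFinD [X in (_ <= _ + (_ * X)%:E)%E]big_nat_recr//= mulrDr [S2 * gam _ ^+ 2]mulrC.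
(* The start is deterministic, so [a 1] is finite, and the telescoped bound with it. *)
have a1 : a 1%N = (b%:R * TB x1 + (b%:R - 1) * gam 1%N * Gap x1)%:E.
  rewrite /a; under eq_integral => om _ do rewrite Hxs1.
  transitivity (\int[P]_om (cst (b%:R * TB x1 + (b%:R - 1) * gam 1%N * Gap x1)%:E) om)%E => //.
  by rewrite integral_cst// [X in (_ * X)%E](_ : _ = 1%E) ?mule1//; exact: probability_setT.
set W := \sum_(2 <= k < N.+2) theta k in Hthetasum *.
pose xbar om : pt R n := fun i => W^-1 *: \sum_(2 <= k < N.+2) theta k *: xs k om i.
have avg om : in_blocks X (xbar om) /\
    W * Gap (xbar om) <= \sum_(2 <= k < N.+2) theta k * Gap (xs k om).
  have t0 j : (2 <= j < N.+2)%N -> 0 <= theta j by move=> jN; exact: Hthetapos.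
  have Xj j : (2 <= j < N.+2)%N -> in_blocks X (xs j om).
    by move=> /andP[/ltnW j1 _]; exact: Xk.
  exact: (gap_average cX Hfconv Hchi xstar t0 Xj Hthetasum).
have mxbar i j : measurable_fun setT (fun om => xbar om i 0 j).
  have -> : (fun om => xbar om i 0 j) =
      (* The measurability of a sum asks for every index, while nothing is known of [xs 0]; the
         dummy 0 fills in, and [wgap] below is cut off likewise for its sign. *)
      (fun om => W^-1 * \sum_(2 <= k < N.+2) (theta k * (if (2 <= k)%N then xs k om i 0 j else 0))).
    apply/funext => om; rewrite /xbar !mxE summxE; congr (_ * _).
    by rewrite !big_nat; apply: eq_bigr => k /andP[-> _]; rewrite !mxE.
  apply: measurable_funM => //; apply: measurable_sum => k; apply: measurable_funM => //.
  case: (boolP (2 <= k)%N) => k2; last exact: measurable_cst.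
  exact: (measurableT_comp (mx k (ltnW k2) i j) (mid k)).
pose wgap k om : \bar R :=
  if (2 <= k <= N.+1)%N then ((theta k)%:E * (Gap (xs k om))%:E)%E else 0%E.
have wgap0 k om : (0 <= wgap k om)%E.
  rewrite /wgap; case: ifP => // /[dup] kN /andP[k2 _].
  by rewrite mule_ge0// lee_fin; [exact: Hthetapos|apply: Gap0; exact: ltnW].
have mwgap k : measurable_fun setT (wgap k).
  rewrite /wgap; case: (boolP (2 <= k <= N.+1)%N) => [/andP[k2 _]|_] //.
  apply: measurable_funeM; apply/measurable_EFinP; apply: mGap; exact: ltnW.
have W0 : 0 <= W^-1 by rewrite invr_ge0 ltW.
rewrite unlock.
apply: (@le_trans _ _ (\int[P]_om (W^-1%:E * \sum_(2 <= k < N.+2) wgap k om))%E).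
  apply: ge0_le_integral => //.
  - by move=> om _; rewrite lee_fin; exact: (gap_ge0 optstar (avg om).1).
  - apply/measurable_EFinP.
    exact: (measurable_gap Hnrm Hgrad Hchi xstar mxbar (fun om => (avg om).1)).
  - by apply: measurable_funeM; exact: emeasurable_sum.
  - move=> om _.
    have -> : (\sum_(2 <= k < N.+2) wgap k om = (\sum_(2 <= k < N.+2) theta k * Gap (xs k om))%:E)%E.
      by rewrite -sumEFin !big_nat; apply: eq_bigr => k kN; rewrite /wgap [X in if X then _ else _]kN.
    by rewrite -EFinM lee_fin ler_pdivlMl//; exact: (avg om).2.
rewrite ge0_integralZl//; last 2 first.
- exact: emeasurable_sum.
- by move=> om _; exact: sume_ge0.
rewrite ge0_integral_sum//.
have -> : (\sum_(2 <= k < N.+2) \int[P]_om wgap k om = \sum_(2 <= k < N.+2) (theta k)%:E * e k)%E.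
  rewrite !big_nat; apply: eq_bigr => k kN; rewrite /wgap /=.
  have kN' : (2 <= k <= N.+1)%N by [].
  rewrite kN' ge0_integralZl//.
  - by apply/measurable_EFinP; apply: mGap; apply: ltnW; case/andP: kN.
  - by move=> om _; rewrite lee_fin; apply: Gap0; apply: ltnW; case/andP: kN.
  - by rewrite lee_fin; exact: Hthetapos.
rewrite EFinM; apply: lee_wpmul2l; first by rewrite lee_fin.
have := tele N (leqnn N); rewrite a1 -EFinD => tN.
(* The final potential [a N.+1] is nonnegative and is given away. *)
apply: (@le_trans _ _ (a N.+1 + \sum_(2 <= k < N.+2) (theta k)%:E * e k)%E).
  by apply: lee_paddl => //; apply: integral_ge0 => om _; rewrite lee_fin B0.
by apply: (le_trans tN); rewrite lee_fin -/(Gap x1) -/(TB x1) -/S2 [X in X + _ <= _]addrC.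
Qed.
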